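(* Let $q$ be a non-zero complex number which is not a root of unity, let $(\alpha,\beta)\in\mathbb{C}^2$ with $\alpha,\beta\neq0$, and let $A_{\alpha,\beta}=U^+/\langle z-\alpha,z'-\beta\rangle$, where $U^+=U_q^+(B_2)$. Then $A_{\alpha,\beta}$ is not isomorphic (as a $\mathbb{C}$-algebra) to a generalized Weyl algebra over the polynomial ring $\mathbb{C}[h]$, nor to a generalized Weyl algebra over the Laurent polynomial ring $\mathbb{C}[h^{\pm1}]$.
   Context: $U^+=U_q^+(B_2)$ is the unital associative $\mathbb{C}$-algebra generated by $e_1,e_2$ subject to the quantum Serre relations $e_1^2e_2-(q^2+q^{-2})e_1e_2e_1+e_2e_1^2=0$ and $e_2^3e_1-(q^2+1+q^{-2})e_2^2e_1e_2+(q^2+1+q^{-2})e_2e_1e_2^2-e_1e_2^3=0$. Set $e_3=e_1e_2-q^2e_2e_1$, $\overline{e_3}=e_1e_2-q^{-2}e_2e_1$, $z=e_2e_3-q^2e_3e_2$ and $z'=(1-q^{-2})\left(e_3\overline{e_3}+(1+q^{-2})ze_1\right)$; the center of $U^+$ is $\mathbb{C}[z,z']$. $\langle z-\alpha,z'-\beta\rangle$ is the two-sided ideal of $U^+$ generated by $z-\alpha$ and $z'-\beta$. Generalized Weyl algebra (GWA): let $R$ be a Noetherian $\mathbb{C}$-algebra which is a domain, $a$ a non-zero central element of $R$ and $\sigma$ a ($\mathbb{C}$-algebra) automorphism of $R$. The GWA $R(\sigma,a)$ is the $\mathbb{C}$-algebra generated over $R$ by two generators $x,y$ with relations $xr=\sigma(r)x$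 and $yr=\sigma^{-1}(r)y$ for all $r\in R$, $xy=\sigma(a)$, $yx=a$. *)

(* Defs.v *)
From HB Require Import structures.
From mathcomp Require Import all_boot all_order all_algebra.
From mathcomp Require Import boolp reals complex.
From mathcomp Require Import multinomials.monalg.

Set Implicit Arguments.
Unset Strict Implicit.
Unset Printing Implicit Defensive.

Import GRing.Theory.
Local Open Scope ring_scope.
Local Open Scope quotient_scope.

(* Associative unital algebras, possibly trivial: a ring with a ring morphism *)
(* from K to its center. MathComp's algType requires 1 != 0, which is not     *)
(* known a priori for an algebra given by generators and relations.           *)
Record algebra (K : comPzRingType) := Algebra {
  alg_ring : pzRingType;
  alg_emb : {rmorphism K -> alg_ring};
  alg_embC : forall c x, alg_emb c * x = x * alg_emb c
}.

Definition alg_sort (K : comPzRingType) (A : algebra K) : Type := alg_ring A.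
Coercion alg_sort : algebra >-> Sortclass.

Section AlgebraInstances.
Variables (K : comPzRingType) (A : algebra K).

HB.instance Definition _ := GRing.PzRing.copy (alg_sort A) (alg_ring A).

Definition alg_scale (c : K) (x : A) : A := (alg_emb A c : A) * x.

Lemma alg_scaleA a b v : alg_scale a (alg_scale b v) = alg_scale (a * b) v.
Proof. by rewrite /alg_scale mulrA rmorphM. Qed.

Lemma alg_scale1 : left_id 1 alg_scale.
Proof. by move=> v; rewrite /alg_scale rmorph1 mul1r. Qed.

Lemma alg_scaleDr : right_distributive alg_scale +%R.
Proof. by move=> c u v; rewrite /alg_scale mulrDr. Qed.

Lemma alg_scaleDl v : {morph alg_scale^~ v : a b / a + b}.
Proof. by move=> a b; rewrite /alg_scale rmorphD mulrDl. Qed.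

HB.instance Definition _ := GRing.Zmodule_isLmodule.Build K (alg_sort A)
  alg_scaleA alg_scale1 alg_scaleDr alg_scaleDl.

End AlgebraInstances.

Definition alg_iso (K : comPzRingType) (A B : algebra K) : Prop :=
  exists f : {rmorphism A -> B}, scalable f /\ bijective f.

Section Quotient.
Variables (K : comPzRingType) (A : algebra K).

Definition two_sided_ideal (J : A -> Prop) : Prop :=
  [/\ J 0, (forall u v, J u -> J v -> J (u + v)),
      (forall a u, J u -> J (a * u)) & (forall a u, J u -> J (u * a))].

Variable S : A -> Prop.

Definition ideal_gen (x : A) : Prop :=
  forall J : A -> Prop, two_sided_ideal J -> (forall s, S s -> J s) -> J x.

Lemma ideal_genP : two_sided_ideal ideal_gen.
Proof.
split.
- by move=> J [].
- by move=> u v Hu Hv J HJ HS; case: (HJ) => _ HD _ _; apply: HD; [exact: Hu|exact: Hv].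
- by move=> a u Hu J HJ HS; case: (HJ) => _ _ HM _; apply: HM; exact: Hu.
- by move=> a u Hu J HJ HS; case: (HJ) => _ _ _ HM; apply: HM; exact: Hu.
Qed.

Definition ideal_pred : A -> bool := fun x => `[< ideal_gen x >].

Lemma ideal_predMl a u : u \in ideal_pred -> a * u \in ideal_pred.
Proof.
by case: ideal_genP => _ _ HM _ /asboolP Hu; apply/asboolP; apply: HM.
Qed.

Lemma ideal_predMr a u : u \in ideal_pred -> u * a \in ideal_pred.
Proof.
by case: ideal_genP => _ _ _ HM /asboolP Hu; apply/asboolP; apply: HM.
Qed.

Lemma ideal_pred_zmod : zmod_closed ideal_pred.
Proof.
case: ideal_genP => H0 HD HM _; split; first exact/asboolP.
move=> u v /asboolP Hu /asboolP Hv; apply/asboolP.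
by apply: HD => //; rewrite -mulN1r; apply: HM.
Qed.

HB.instance Definition _ := GRing.isZmodClosed.Build A ideal_pred
  ideal_pred_zmod.

Definition quot_sort : Type := Quotient.quot (GRing.ZmodClosed.clone A ideal_pred _).

HB.instance Definition _ := GRing.Zmodule.on quot_sort.
HB.instance Definition _ := EqQuotient.on quot_sort.

Local Notation pi := (\pi_quot_sort : A -> quot_sort).

Lemma quot_piE x y : (pi x == pi y) = (x - y \in ideal_pred).
Proof. by rewrite Quotient.idealrBE. Qed.

Definition quot_one : quot_sort := pi 1.
Definition quot_mul (x y : quot_sort) : quot_sort := pi (repr x * repr y).

Lemma quot_pi_add x y : pi (x + y) = pi x + pi y.
Proof. by rewrite Quotient.pi_add. Qed.

Lemma quot_pi_mul x y : pi (x * y) = quot_mul (pi x) (pi y).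
Proof.
apply/eqP; rewrite quot_piE.
set x' := repr _; set y' := repr _.
have hx : x - x' \in ideal_pred by rewrite -quot_piE reprK.
have hy : y - y' \in ideal_pred by rewrite -quot_piE reprK.
have -> : x * y - x' * y' = (x - x') * y + x' * (y - y').
  by rewrite mulrBl mulrBr addrA subrK.
by apply: rpredD; [exact: ideal_predMr|exact: ideal_predMl].
Qed.

Lemma quot_surj (x : quot_sort) : exists y, x = pi y.
Proof. by exists (repr x); rewrite reprK. Qed.

Lemma quot_mulA : associative quot_mul.
Proof.
move=> x y z; have [x' ->] := quot_surj x; have [y' ->] := quot_surj y.
have [z' ->] := quot_surj z.
by rewrite -!quot_pi_mul mulrA.
Qed.

Lemma quot_mul1 : left_id quot_one quot_mul.
Proof. by move=> x; have [x' ->] := quot_surj x; rewrite -quot_pi_mul mul1r. Qed.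

Lemma quot_mulr1 : right_id quot_one quot_mul.
Proof. by move=> x; have [x' ->] := quot_surj x; rewrite -quot_pi_mul mulr1. Qed.

Lemma quot_mulDl : left_distributive quot_mul +%R.
Proof.
move=> x y z; have [x' ->] := quot_surj x; have [y' ->] := quot_surj y.
have [z' ->] := quot_surj z.
by rewrite -!(quot_pi_mul, quot_pi_add) mulrDl.
Qed.

Lemma quot_mulDr : right_distributive quot_mul +%R.
Proof.
move=> x y z; have [x' ->] := quot_surj x; have [y' ->] := quot_surj y.
have [z' ->] := quot_surj z.
by rewrite -!(quot_pi_mul, quot_pi_add) mulrDr.
Qed.

HB.instance Definition _ := GRing.Zmodule_isPzRing.Build quot_sort
  quot_mulA quot_mul1 quot_mulr1 quot_mulDl quot_mulDr.

Lemma quot_pi_sub x y : pi (x - y) = pi x - pi y.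
Proof. by apply: (addIr (pi y)); rewrite -quot_pi_add !subrK. Qed.

Definition quot_emb (c : K) : quot_sort := pi (alg_emb A c : A).

Lemma quot_emb_zmod : zmod_morphism quot_emb.
Proof. by move=> a b; rewrite /quot_emb rmorphB quot_pi_sub. Qed.

Lemma quot_emb_monoid : monoid_morphism quot_emb.
Proof.
split; first by rewrite /quot_emb rmorph1.
by move=> a b; rewrite /quot_emb rmorphM quot_pi_mul.
Qed.

HB.instance Definition _ := GRing.isZmodMorphism.Build K quot_sort quot_emb
  quot_emb_zmod.
HB.instance Definition _ := GRing.isMonoidMorphism.Build K quot_sort quot_emb
  quot_emb_monoid.

Lemma quot_embC c x : quot_emb c * x = x * quot_emb c.
Proof.
have [x' ->] := quot_surj x; rewrite /quot_emb.
by rewrite -[LHS]quot_pi_mul -[RHS]quot_pi_mul; congr pi; exact: alg_embC.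
Qed.

Definition quot : algebra K := Algebra quot_embC.

Definition quot_pi (x : A) : quot := pi x.

End Quotient.

Section FreeAlgebra.
Variables (K : fieldType) (X : choiceType).

Lemma free_embC (c : K) (x : {malg K[{fmonom X}]}) : c%:MP * x = x * c%:MP.
Proof.
rewrite [LHS]fgmulUg [RHS]fgmulgU; apply: eq_bigr => k _.
by rewrite mul1m mulm1 mulrC.
Qed.

Definition free : algebra K :=
  @Algebra K {malg K[{fmonom X}]} (@malgC {fmonom X} K) free_embC.

Definition free_gen (i : X) : free := << fmu i >> : {malg K[{fmonom X}]}.

End FreeAlgebra.

Arguments free K X : clear implicits.
Arguments free_gen K {X} i.

(* The K-algebra K[h, h^-1], as the subring of the fractions p / h^n of K(h). *)
Section Laurent.
Variable K : fieldType.

Local Notation "x %:F" := (tofrac x).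

Definition laurent_pred : {fraction {poly K}} -> bool :=
  fun x => `[< exists (p : {poly K}) (n : nat), x = p%:F / 'X%:F ^+ n >].

Lemma laurent_subring : subring_closed laurent_pred.
Proof.
have X0 n : ('X : {poly K})%:F ^+ n != 0.
  by rewrite expf_neq0 // tofrac_eq0 polyX_eq0.
split.
- by apply/asboolP; exists 1, 0%N; rewrite expr0 divr1 rmorph1.
- move=> _ _ /asboolP[p [m ->]] /asboolP[r [n ->]]; apply/asboolP.
  exists (p * 'X ^+ n - r * 'X ^+ m), (m + n)%N.
  rewrite rmorphB !rmorphM !rmorphXn /= exprD.
  by rewrite -[- (r%:F / _)]mulNr addf_div // mulNr.
- move=> _ _ /asboolP[p [m ->]] /asboolP[r [n ->]]; apply/asboolP.
  by exists (p * r), (m + n)%N; rewrite rmorphM exprD mulf_div.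
Qed.

HB.instance Definition _ :=
  GRing.isSubringClosed.Build {fraction {poly K}} laurent_pred laurent_subring.

Definition laurent := {x : {fraction {poly K}} | laurent_pred x}.

HB.instance Definition _ := SubChoice.on laurent.
HB.instance Definition _ := [SubChoice_isSubComNzRing of laurent by <:].

Lemma laurent_polyP (p : {poly K}) : laurent_pred p%:F.
Proof. by apply/asboolP; exists p, 0%N; rewrite expr0 divr1. Qed.

Definition laurent_poly (p : {poly K}) : laurent := Sub p%:F (laurent_polyP p).

Lemma laurent_poly_zmod : zmod_morphism laurent_poly.
Proof. by move=> p r; apply: val_inj; rewrite rmorphB !SubK rmorphB. Qed.

Lemma laurent_poly_monoid : monoid_morphism laurent_poly.
Proof.
split; first by apply: val_inj; rewrite rmorph1 SubK rmorph1.
by move=> p r; apply: val_inj; rewrite rmorphM !SubK rmorphM.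
Qed.

HB.instance Definition _ :=
  GRing.isZmodMorphism.Build {poly K} laurent laurent_poly laurent_poly_zmod.
HB.instance Definition _ :=
  GRing.isMonoidMorphism.Build {poly K} laurent laurent_poly laurent_poly_monoid.

Definition laurent_scale (c : K) (x : laurent) : laurent :=
  laurent_poly c%:P * x.

Lemma laurent_scaleA a b v :
  laurent_scale a (laurent_scale b v) = laurent_scale (a * b) v.
Proof. by rewrite /laurent_scale mulrA !rmorphM. Qed.

Lemma laurent_scale1 : left_id 1 laurent_scale.
Proof. by move=> v; rewrite /laurent_scale !rmorph1 mul1r. Qed.

Lemma laurent_scaleDr : right_distributive laurent_scale +%R.
Proof. by move=> c u v; rewrite /laurent_scale mulrDr. Qed.

Lemma laurent_scaleDl v : {morph laurent_scale^~ v : a b / a + b}.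
Proof. by move=> a b; rewrite /laurent_scale !rmorphD mulrDl. Qed.

HB.instance Definition _ := GRing.Zmodule_isLmodule.Build K laurent
  laurent_scaleA laurent_scale1 laurent_scaleDr laurent_scaleDl.

Lemma laurent_scaleAl (c : K) (u v : laurent) : c *: (u * v) = (c *: u) * v.
Proof. by rewrite -[LHS]/(_ * _) -[c *: u]/(_ * _) mulrA. Qed.

HB.instance Definition _ := GRing.Lmodule_isLalgebra.Build K laurent
  laurent_scaleAl.
HB.instance Definition _ := GRing.Lalgebra_isComAlgebra.Build K laurent.

End Laurent.

Section GWA.
Variables (K : fieldType) (R : algType K).

(* R(sigma, a), with sigma' in the role of the inverse of sigma.              *)
Variables (sigma : {lrmorphism R -> R}) (sigma' : R -> R) (a : R).

(* Generators: the elements of R, together with x and y.                      *)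
Local Notation F := (free K (R + bool)%type).
Local Notation "[ r ]" := (free_gen K (inl r : (R + bool)%type)).
Local Notation x := (free_gen K (inr true : (R + bool)%type)).
Local Notation y := (free_gen K (inr false : (R + bool)%type)).

Inductive gwa_relator : F -> Prop :=
(* the map r |-> [r] is a morphism of K-algebras *)
| GwaD (r s : R) : gwa_relator ([r + s] - ([r] + [s]))
| GwaZ (c : K) (r : R) : gwa_relator ([c *: r] - c *: [r])
| Gwa1 : gwa_relator ([1] - 1)
| GwaM (r s : R) : gwa_relator ([r * s] - [r] * [s])
(* the defining relations of the generalized Weyl algebra *)
| GwaX (r : R) : gwa_relator (x * [r] - [sigma r] * x)
| GwaY (r : R) : gwa_relator (y * [r] - [sigma' r] * y)
| GwaXY : gwa_relator (x * y - [sigma a])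
| GwaYX : gwa_relator (y * x - [a]).

Definition gwa : algebra K := quot gwa_relator.

End GWA.

(* A standing assumption on R, that it is a Noetherian domain, is not part of *)
(* the definition: it is only used for R = K[h] and R = K[h, h^-1].           *)
Definition iso_gwa_over (K : fieldType) (A : algebra K) (R : algType K) : Prop :=
  exists (sigma : {lrmorphism R -> R}) (sigma' : R -> R) (a : R),
    [/\ cancel sigma sigma', cancel sigma' sigma,
        a != 0, (forall r, a * r = r * a) &
        alg_iso A (gwa sigma sigma' a)].

(* The algebra U_q^+(B_2) and its quotients by <z - alpha, z' - beta>.        *)
Section UqB2.
Variables (K : fieldType) (q : K).

Local Notation F := (free K 'I_2).

Definition serre_relator (u : F) : Prop :=
  let e1 : F := free_gen K ord0 in
  let e2 : F := free_gen K ord_max in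
  let c := q ^+ 2 + 1 + q ^- 2 in
  u = e1 ^+ 2 * e2 - (q ^+ 2 + q ^- 2) *: (e1 * e2 * e1) + e2 * e1 ^+ 2
  \/
  u = e2 ^+ 3 * e1 - c *: (e2 ^+ 2 * e1 * e2) + c *: (e2 * e1 * e2 ^+ 2)
      - e1 * e2 ^+ 3.

Definition Uq : algebra K := quot serre_relator.

Definition e1 : Uq := quot_pi serre_relator (free_gen K ord0).
Definition e2 : Uq := quot_pi serre_relator (free_gen K ord_max).
Definition e3 : Uq := e1 * e2 - q ^+ 2 *: (e2 * e1).
Definition e3bar : Uq := e1 * e2 - q ^- 2 *: (e2 * e1).
Definition z : Uq := e2 * e3 - q ^+ 2 *: (e3 * e2).
Definition z' : Uq :=
  (1 - q ^- 2) *: (e3 * e3bar + (1 + q ^- 2) *: (z * e1)).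

Definition A_ (alpha beta : K) : algebra K :=
  quot (fun u : Uq => u = z - alpha *: (1 : Uq) \/ u = z' - beta *: (1 : Uq)).

End UqB2.

(* Main.v *)
Require Import Defs.
From HB Require Import structures.
From mathcomp Require Import all_boot all_order all_algebra.
From mathcomp Require Import finmap boolp functions reals complex.
From mathcomp Require Import multinomials.monalg.
From mathcomp Require Import ring zify.

(* Put x3 = e3. In A = A_{alpha,beta}, e1 x3 = q^-2 x3 e1 and                *)
(* e2 x3 - q^2 x3 e2 = alpha != 0, so A has no character. An automorphism     *)
(* sigma of K[h] either fixes a point of the line, which gives a character of *)
(* the generalized Weyl algebra, or is a translation. In the latter case the  *)
(* leading coefficient in h is multiplicative and sigma-invariant; applied to *)
(* the extreme terms in the Z-grading, it contradicts e1 x3 = q^-2 x3 e1.     *)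
(*   Over K[h, h^-1] the generalized Weyl algebra, hence A, is a domain, and  *)
(* h gives a unit u of A. Inverting e1 (resp. x3) turns A into a domain that  *)
(* is Z-graded by q-commutation with e1 (resp. x3), so u q-commutes with e1   *)
(* and with x3. On two highest weight modules, one with a vector killed by e1 *)
(* and one with a vector killed by x3, the relation z' = beta forces both     *)
(* commutation factors to be 1. Hence u is central; then K[h, h^-1] is        *)
(* central and the generalized Weyl algebra is commutative, a contradiction.  *)

(** An isomorphism with a generalized Weyl algebra G transports the relations [b2_relations], which
    hold in the primitive quotient because z and z' have become scalars ([A_relations]). G acts on
    functions from Z to R by twisted shifts. Given a multiplicative, sigma-invariant [v] from R to K
    that vanishes only at 0, every nonzero element of G has a nonzero top coefficient ([gwa_top]),
    and these multiply. So G is a domain ([gwa_domain]); if [v] also respects scalars, then g h = c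
    h g with g, h nonzero forces c = 1 ([gwa_no_qcommuting]).

    Over K[h], sigma is an affine substitution. If its slope is not 1, it has a fixed point, and
    evaluation there gives a one-dimensional module, excluded by [b2_no_character]. If the slope is
    1, the leading coefficient serves as [v], and e1 e3 = q^-2 e3 e1 contradicts q^2 != 1.

    Over K[h, h^-1], [v] is merely the indicator of nonzero elements, which still gives a domain.
    The unit h must q-commute with e1 and with e3 ([unit_qcommutes]), because units of a graded
    domain are homogeneous. The two modules supplied by [A_verma] force both factors to be 1, so h
    is central ([unit_central]). Then G is commutative, which the same relation forbids. *)

Set Implicit Arguments.
Unset Strict Implicit.
Unset Printing Implicit Defensive.

Import Order.TTheory GRing.Theory Num.Theory.
Local Open Scope ring_scope.

(** * Modules over quotients of free algebras *)

Section Algebra.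
Variables (K : comPzRingType) (A : algebra K).
Implicit Types (c : K) (x y : A).

Lemma algZE c x : c *: x = (alg_emb A c : A) * x. Proof. by []. Qed.

Lemma algZl c x y : (c *: x) * y = c *: (x * y).
Proof. by rewrite !algZE mulrA. Qed.

Lemma algZr c x y : x * (c *: y) = c *: (x * y).
Proof. by rewrite !algZE !mulrA; congr (_ * y); exact: (esym (alg_embC c x)). Qed.

End Algebra.

(** The action is kept apart from its carrier, because one space carries several module structures:
    both modules used in [unit_central] live on the same [M]. *)
Record action (K : comPzRingType) (A : algebra K) (M : lmodType K) := Action {
  act :> A -> M -> M;
  act_linearl : forall m, linear (act^~ m);
  act_linearr : forall u, linear (act u);
  act1 : forall m, act 1 m = m;
  actM : forall u v m, act (u * v) m = act u (act v m) }.

Section ActionTheory.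
Variables (K : comPzRingType) (A : algebra K) (M : lmodType K).
Variable rho : action A M.

Definition act_at (m : M) (u : A) : M := rho u m.

HB.instance Definition _ m := GRing.isLinear.Build K A M *:%R (act_at m)
  (act_linearl rho m).
HB.instance Definition _ u := GRing.isLinear.Build K M M *:%R (rho u)
  (act_linearr rho u).

Lemma actDl u v m : rho (u + v) m = rho u m + rho v m.
Proof. exact: (linearD (act_at m)). Qed.
Lemma actBl u v m : rho (u - v) m = rho u m - rho v m.
Proof. exact: (linearB (act_at m)). Qed.
Lemma actZl c u m : rho (c *: u) m = c *: rho u m.
Proof. exact: (linearZ_LR (act_at m)). Qed.
Lemma act0l m : rho 0 m = 0.
Proof. exact: (linear0 (act_at m)). Qed.

Lemma actZr c u m : rho u (c *: m) = c *: rho u m.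
Proof. exact: linearZ_LR. Qed.

Lemma act_eigen2 c d u m : c *: rho u m = d *: m ->
  (c * c) *: rho u (rho u m) = (d * d) *: m.
Proof. by move=> E; rewrite -scalerA -actZr E actZr scalerA mulrC -[LHS]scalerA E scalerA. Qed.

End ActionTheory.

Section FreeAction.
Variables (K : fieldType) (X : choiceType) (M : lmodType K).
Variable op : X -> M -> M.
Hypothesis op_lin : forall i, linear (op i).

Local Notation F := {malg K[{fmonom X}]}.

Definition word_act (w : seq X) (m : M) : M := foldr op m w.

Definition free_act (u : F) (m : M) : M :=
  \sum_(k <- msupp u) u@_k *: word_act k m.

Lemma word_act_lin w : linear (word_act w).
Proof. by elim: w => [|i w IH] // c m n /=; rewrite IH op_lin. Qed.

(** Supports change under addition, so linearity in [u] is proved by summing over a common finite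
    set of words. *)
Lemma free_actEw (d : {fset {fmonom X}}) u m : (msupp u `<=` d)%fset ->
  free_act u m = \sum_(k <- d) u@_k *: word_act k m.
Proof.
move=> le; rewrite [LHS](big_fset_incl _ le) => //= x xd /mcoeff_outdom ->.
by rewrite scale0r.
Qed.

Lemma free_actU c k m : free_act << c *g k >> m = c *: word_act k m.
Proof. by rewrite (free_actEw _ msuppU_le) big_seq_fset1 mcoeffUU. Qed.

Lemma free_act_linl m : linear (free_act^~ m).
Proof.
move=> c u v /=; pose d := (msupp u `|` msupp v)%fset.
rewrite (free_actEw (d := d) _ (fsubsetUl _ _)).
rewrite (free_actEw (d := d) _ (fsubsetUr _ _)) (@free_actEw d).
  rewrite scaler_sumr -big_split; apply: eq_bigr => k _ /=.
  by rewrite mcoeffD mcoeffZ scalerDl scalerA.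
apply: fsubset_trans (msuppD_le _ _) _.
by apply: fsetUSS => //; apply: msuppZ_le.
Qed.

Lemma free_act_linr u : linear (free_act u).
Proof.
move=> c m n; rewrite /free_act scaler_sumr -big_split; apply: eq_bigr => k _.
by rewrite word_act_lin /= scalerDr !scalerA mulrC.
Qed.

Definition free_act_at (m : M) (u : F) : M := free_act u m.

HB.instance Definition _ m := GRing.isLinear.Build K F M *:%R (free_act_at m)
  (free_act_linl m).
HB.instance Definition _ w := GRing.isLinear.Build K M M *:%R (word_act w)
  (word_act_lin w).

Lemma free_act1 m : free_act 1 m = m.
Proof. by rewrite [1]/(<< _ >>) free_actU scale1r fm1. Qed.

Lemma free_actM u v m : free_act (u * v) m = free_act u (free_act v m).
Proof.
rewrite [u in LHS]monalgE mulr_suml -/(free_act_at m _).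
rewrite (linear_sum (free_act_at m)); apply: eq_bigr => k _.
rewrite [v in LHS]monalgE mulr_sumr (linear_sum (free_act_at m)).
rewrite /free_act_at /free_act (linear_sum (word_act k)) scaler_sumr.
apply: eq_bigr => l _; rewrite /free_act_at malgM_def fgmulUU; rewrite [LHS]free_actU (linearZ_LR (word_act k)) scalerA.
by rewrite fmM /word_act foldr_cat.
Qed.

Lemma free_act_alg_linl m :
  linear (fun u : Defs.free K X => free_act (u : F) m).
Proof.
move=> c u v; rewrite -free_act_linl; congr (free_act (_ + _) _).
exact: (mul_malgC c (u : F)).
Qed.

Definition free_action : action (Defs.free K X) M :=
  @Action _ (Defs.free K X) _ _ free_act_alg_linl free_act_linr free_act1 free_actM.

Lemma free_action_gen i m : free_action (free_gen K i) m = op i m.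
Proof. by rewrite [LHS]free_actU scale1r fmU. Qed.

End FreeAction.

Section QuotientTheory.
Variables (K : comPzRingType) (A : algebra K) (S : A -> Prop).

Local Notation pi := (quot_pi S).

Lemma quot_piD u v : pi (u + v) = pi u + pi v. Proof. exact: quot_pi_add. Qed.
Lemma quot_piB u v : pi (u - v) = pi u - pi v. Proof. exact: quot_pi_sub. Qed.
Lemma quot_piM u v : pi (u * v) = pi u * pi v. Proof. exact: quot_pi_mul. Qed.
Lemma quot_pi1 : pi 1 = 1. Proof. by []. Qed.
Lemma quot_piZ c u : pi (c *: u) = c *: pi u.
Proof. by rewrite algZE quot_piM. Qed.

Lemma quot_pi_qcomm (c : K) (u v x y : A) :
  pi (u * v - c *: (x * y)) = pi u * pi v - c *: (pi x * pi y).
Proof. by rewrite quot_piB quot_piM -[pi x * _]quot_piM -[_ *: pi _]quot_piZ. Qed.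

Lemma quot_pi_scaled_sum (c d : K) (u v x y : A) :
  pi (c *: (u * v + d *: (x * y))) = c *: (pi u * pi v + d *: (pi x * pi y)).
Proof.
by rewrite [LHS]quot_piZ quot_piD quot_piM -[pi x * _]quot_piM -[_ *: pi (x * y)]quot_piZ.
Qed.

Lemma quot_pi_surj (x : quot S) : exists u, x = pi u.
Proof. exact: quot_surj. Qed.

Lemma quot_pi_eq u v : ideal_gen S (u - v) -> pi u = pi v.
Proof.
by move=> /asboolP h; have := @quot_piE _ _ S u v; rewrite [X in _ = X]h => /eqP.
Qed.

Lemma quot_piE_eq u v : pi u = pi v -> ideal_gen S (u - v).
Proof.
move=> h; have := @quot_piE _ _ S u v.
by rewrite [X in (X == _) = _]h eqxx => /esym/asboolP.
Qed.

Lemma quot_pi_rel u v : S (u - v) -> pi u = pi v.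
Proof. by move=> h; apply: quot_pi_eq => J _; exact. Qed.

Variable M : lmodType K.
Variable rho : action A M.
Hypothesis rhoS : forall s, S s -> forall m, rho s m = 0.

Definition quot_act (x : quot S) (m : M) : M :=
  rho (repr (x : quot_sort S)) m.

(** The annihilator of [M] is a two-sided ideal containing [S], hence the ideal generated by [S]; so
    the chosen representative does not matter. *)
Lemma quot_actE u m : quot_act (pi u) m = rho u m.
Proof.
apply/eqP; rewrite -subr_eq0 -actBl; apply/eqP.
have : ideal_gen S (repr (pi u : quot_sort S) - u).
  by apply: quot_piE_eq; rewrite /quot_pi reprK.
move/(_ (fun w => forall m, rho w m = 0)); apply => [|s /rhoS//].
split=> [n|v w hv hw n|v w hw n|v w hw n]; first by rewrite act0l.
- by rewrite actDl hv hw addr0.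
- by rewrite actM hw linear0.
- by rewrite actM hw.
Qed.

Lemma quot_act_linl m : linear (quot_act^~ m).
Proof.
move=> c x y; have [u ->] := quot_pi_surj x; have [v ->] := quot_pi_surj y.
by rewrite /= -quot_piZ -quot_piD !quot_actE act_linearl.
Qed.

Lemma quot_act_linr x : linear (quot_act x).
Proof. exact: act_linearr. Qed.

Lemma quot_act1 m : quot_act 1 m = m.
Proof. by rewrite -quot_pi1 quot_actE act1. Qed.

Lemma quot_actM x y m : quot_act (x * y) m = quot_act x (quot_act y m).
Proof.
have [u ->] := quot_pi_surj x; have [v ->] := quot_pi_surj y.
by rewrite -quot_piM !quot_actE actM.
Qed.

Definition quot_action : action (quot S) M :=
  Action quot_act_linl quot_act_linr quot_act1 quot_actM.

Lemma quot_actionE u m : quot_action (pi u) m = rho u m.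
Proof. exact: quot_actE. Qed.

End QuotientTheory.

Section Generation.
Variables (K : fieldType).

Definition subalgebra (A : algebra K) (P : A -> Prop) : Prop :=
  [/\ forall c, P (c *: (1 : A)), forall x y, P x -> P y -> P (x + y) &
      forall x y, P x -> P y -> P (x * y)].

Lemma free_ind (X : choiceType) (P : Defs.free K X -> Prop) :
  subalgebra P -> (forall i, P (free_gen K i)) -> forall x, P x.
Proof.
move=> [PZ PD PM] PX x.
have P0 : P 0 by have := PZ 0; rewrite scale0r.
have P1 : P 1 by have := PZ 1; rewrite scale1r.
have Pw (w : fmonom X) : P << w >>.
  rewrite -(fmK w); elim: (fmonom_val w) => [|i s IH].
    by rewrite -fmoneE.
  have -> : (<< FMonom (i :: s) >> : Defs.free K X) = free_gen K i * << FMonom s >>.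
    rewrite [RHS]fgmulUU mulr1; congr << _ >>; apply/eqP.
    by rewrite -val_eqE /= fmM fmU.
  exact: PM.
rewrite (monalgE x); elim: (enum_fset (msupp x)) => [|k s IH].
  by rewrite big_nil.
rewrite big_cons; apply: PD => //.
have -> : (<< x@_k *g k >> : Defs.free K X) = (x@_k *: (1 : Defs.free K X)) * << k >>.
  by rewrite algZl mul1r algZE [RHS]fgmulUU mulr1 mul1m.
exact: PM.
Qed.

Lemma subalgebra_pi (A : algebra K) (S : A -> Prop) (P : quot S -> Prop) :
  subalgebra P -> subalgebra (fun u => P (quot_pi S u)).
Proof.
move=> [PZ PD PM]; split=> [c|x y hx hy|x y hx hy].
- by rewrite quot_piZ; exact: PZ.
- by rewrite quot_piD; exact: PD.
- by rewrite quot_piM; exact: PM.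
Qed.

End Generation.

(** * Identities in noncommutative algebras *)

(** Reflection for identities in a noncommutative algebra: an expression is expanded into a list of
    coefficients and words, equal words are collected, and only scalar equations remain. The list
    operations are redefined so that the final reduction unfolds them without touching the
    coefficients. *)
Inductive nc_expr (K : Type) :=
| NcX of nat
| Nc1
| NcAdd of nc_expr K & nc_expr K
| NcOpp of nc_expr K
| NcMul of nc_expr K & nc_expr K
| NcScale of K & nc_expr K.

Arguments NcX {K}.
Arguments Nc1 {K}.

Section NcNormal.
Variables (K : fieldType) (A : algebra K).

Fixpoint nc_eval (env : seq A) (e : nc_expr K) : A :=
  match e with
  | NcX i => nth 0 env i
  | Nc1 => 1
  | NcAdd e f => nc_eval env e + nc_eval env f
  | NcOpp e => - nc_eval env e
  | NcMul e f => nc_eval env e * nc_eval env f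
  | NcScale c e => c *: nc_eval env e
  end.

Fixpoint nc_cat (l m : seq (K * seq nat)) :=
  if l is a :: l' then a :: nc_cat l' m else m.

Fixpoint nc_wcat (v w : seq nat) := if v is i :: v' then i :: nc_wcat v' w else w.

Fixpoint nc_scale (c : K) (l : seq (K * seq nat)) :=
  if l is (d, w) :: l' then (c * d, w) :: nc_scale c l' else [::].

Fixpoint nc_mul1 (c : K) (v : seq nat) (l : seq (K * seq nat)) :=
  if l is (d, w) :: l' then (c * d, nc_wcat v w) :: nc_mul1 c v l' else [::].

Fixpoint nc_mul (l m : seq (K * seq nat)) :=
  if l is (c, v) :: l' then nc_cat (nc_mul1 c v m) (nc_mul l' m) else [::].

Fixpoint nc_norm (e : nc_expr K) : seq (K * seq nat) :=
  match e with
  | NcX i => [:: (1, [:: i])]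
  | Nc1 => [:: (1, [::])]
  | NcAdd e f => nc_cat (nc_norm e) (nc_norm f)
  | NcOpp e => nc_scale (-1) (nc_norm e)
  | NcMul e f => nc_mul (nc_norm e) (nc_norm f)
  | NcScale c e => nc_scale c (nc_norm e)
  end.

Fixpoint nc_weq (v w : seq nat) : bool :=
  match v, w with
  | [::], [::] => true
  | i :: v', j :: w' => if eqn i j then nc_weq v' w' else false
  | _, _ => false
  end.

Fixpoint nc_insert (c : K) (v : seq nat) (l : seq (K * seq nat)) :=
  if l is (d, w) :: l' then
    if nc_weq v w then (c + d, w) :: l' else (d, w) :: nc_insert c v l'
  else [:: (c, v)].

Fixpoint nc_collect (l : seq (K * seq nat)) :=
  if l is (c, v) :: l' then nc_insert c v (nc_collect l') else [::].

Fixpoint nc_null (l : seq (K * seq nat)) : Prop :=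
  if l is (c, v) :: l' then c = 0 /\ nc_null l' else True.

Definition nc_word (env : seq A) (w : seq nat) : A :=
  foldr (fun i x => nth 0 env i * x) 1 w.

Definition nc_sum (env : seq A) (l : seq (K * seq nat)) : A :=
  foldr (fun cw x => cw.1 *: nc_word env cw.2 + x) 0 l.

Variable env : seq A.

Lemma nc_sum_cat l m : nc_sum env (nc_cat l m) = nc_sum env l + nc_sum env m.
Proof. by elim: l => [|a l IH] /=; rewrite ?add0r // IH addrA. Qed.

Lemma nc_word_cat v w : nc_word env (nc_wcat v w) = nc_word env v * nc_word env w.
Proof. by elim: v => [|i v IH] /=; rewrite ?mul1r // IH mulrA. Qed.

Lemma nc_sum_scale c l : nc_sum env (nc_scale c l) = c *: nc_sum env l.
Proof.
by elim: l => [|[d w] l IH] /=; rewrite ?scaler0 // IH scalerDr scalerA.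
Qed.

Lemma nc_sum_mul l m : nc_sum env (nc_mul l m) = nc_sum env l * nc_sum env m.
Proof.
elim: l => [|[c v] l IH] /=; rewrite ?mul0r // nc_sum_cat IH mulrDl.
congr (_ + _); elim: m {IH} => [|[d w] m IH] /=; first by rewrite mulr0.
by rewrite IH nc_word_cat mulrDr !algZl !algZr scalerA.
Qed.

Lemma nc_normE e : nc_sum env (nc_norm e) = nc_eval env e.
Proof.
elim: e => [i||e IHe f IHf|e IHe|e IHe f IHf|c e IHe] /=.
- by rewrite scale1r mulr1 addr0.
- by rewrite scale1r addr0.
- by rewrite nc_sum_cat IHe IHf.
- by rewrite nc_sum_scale scaleN1r IHe.
- by rewrite nc_sum_mul IHe IHf.
- by rewrite nc_sum_scale IHe.
Qed.

Lemma nc_weqP v w : nc_weq v w -> v = w.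
Proof.
elim: v w => [|i v IH] [|j w] //=; case: ifP => // /eqnP -> /IH -> //.
Qed.

Lemma nc_sum_collect l : nc_sum env (nc_collect l) = nc_sum env l.
Proof.
elim: l => [|[c v] l /= <-] //; elim: (nc_collect l) => [|[d w] m IH] //=.
case: ifP => [/nc_weqP <-|_] /=; first by rewrite scalerDl addrA.
by rewrite IH addrCA.
Qed.

Lemma nc_sum_null l : nc_null l -> nc_sum env l = 0.
Proof.
by elim: l => [|[c v] l IH] //= [-> /IH->]; rewrite scale0r addr0.
Qed.

Lemma nc_eqP e f :
  nc_null (nc_collect (nc_norm (NcAdd e (NcOpp f)))) ->
  nc_eval env e = nc_eval env f.
Proof.
move/nc_sum_null; rewrite nc_sum_collect nc_normE /= => /eqP.
by rewrite subr_eq0 => /eqP.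
Qed.

End NcNormal.

Ltac nc_index x env :=
  lazymatch env with
  | x :: _ => constr:(0%N)
  | _ :: ?env' => let i := nc_index x env' in constr:(S i)
  end.

Ltac nc_reify K env t :=
  lazymatch t with
  | (?a + ?b)%R => let e := nc_reify K env a in let f := nc_reify K env b in
                 constr:(@NcAdd K e f)
  | (- ?a)%R => let e := nc_reify K env a in constr:(@NcOpp K e)
  | (?a * ?b)%R => let e := nc_reify K env a in let f := nc_reify K env b in
                 constr:(@NcMul K e f)
  | (?c *: ?a)%R => let e := nc_reify K env a in constr:(@NcScale K c e)
  | @GRing.one _ => constr:(@Nc1 K)
  | _ => let i := nc_index t env in constr:(@NcX K i)
  end.

(* Reduces an equation in the noncommutative variables [env] to the equality *)
(* of the coefficients of every word.                                        *)
Ltac nc_ring K A env :=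
  lazymatch goal with
  | |- ?a = ?b =>
    let e := nc_reify K env a in
    let f := nc_reify K env b in
    change (@nc_eval K A env e = @nc_eval K A env f);
    apply: nc_eqP;
    lazy beta iota zeta delta [nc_null nc_collect nc_insert nc_weq nc_norm nc_mul
      nc_mul1 nc_scale nc_wcat nc_cat eqn];
    repeat split
  end.

(** * Gradings by q-commutation *)

Section Weights.
Variables (A : nzRingType) (e p p' : A).
Hypothesis dom : forall x y : A, x * y = 0 -> x = 0 \/ y = 0.
Hypothesis pC : forall x, p * x = x * p.
Hypothesis p'C : forall x, p' * x = x * p'.
Hypothesis pV : p * p' = 1.
Hypothesis e0 : e != 0.
Hypothesis p_inf : forall n, (0 < n)%N -> p ^+ n != 1.

Implicit Types (x y v w c d : A) (L M n : nat).

(** In the localisation at [e] this says e c e^-1 = p^(M - L) c. Two natural exponents encode an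
    integer weight. *)
Definition weighted (L M : nat) (c : A) : Prop :=
  p ^+ L * (e * c) = p ^+ M * (c * e).

(** The polynomial only stores homogeneous components: the coefficient of index k has weight k - L,
    and evaluation at 1 adds them up. Products of such sums become products of polynomials. *)
Definition wsum (w : A) : Prop :=
  exists L (P : {poly A}), w = P.[1] /\ forall k, weighted L k P`_k.

Lemma mulf_eq0r x y : x * y = 0 -> y != 0 -> x = 0.
Proof. by case/dom => // ->; rewrite eqxx. Qed.

Lemma mulf_eq0l x y : x * y = 0 -> x != 0 -> y = 0.
Proof. by case/dom => // ->; rewrite eqxx. Qed.

Lemma dom_mulf_neq0 x y : x != 0 -> y != 0 -> x * y != 0.
Proof. by move=> x0 y0; apply/eqP => /dom[] /eqP; apply/negP. Qed.

Lemma dom_expf_neq0 x n : x != 0 -> x ^+ n != 0.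
Proof.
by move=> x0; elim: n => [|n IH]; rewrite ?oner_neq0 // exprS dom_mulf_neq0.
Qed.

Lemma expC n x : p ^+ n * x = x * p ^+ n.
Proof. by elim: n => [|n IH]; rewrite ?mul1r ?mulr1 // !exprS -mulrA IH !mulrA pC. Qed.

Lemma expC' n x : p' ^+ n * x = x * p' ^+ n.
Proof. by elim: n => [|n IH]; rewrite ?mul1r ?mulr1 // !exprS -mulrA IH !mulrA p'C. Qed.

Lemma expVK n x : p' ^+ n * (p ^+ n * x) = x.
Proof.
elim: n x => [|n IH] x; first by rewrite !mul1r.
by rewrite exprSr [p ^+ n.+1]exprS -!mulrA [p' * _]mulrA p'C pV mul1r IH.
Qed.

Lemma expp_inj : injective (fun n => p ^+ n).
Proof.
suff H m n : p ^+ m = p ^+ (m + n) -> n = 0%N.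
  move=> m n /= E; case: (leqP m n) => [le|/ltnW le].
    by move: E; rewrite -(subnKC le) => /H ->; rewrite addn0.
  by move: E; rewrite -(subnKC le) => /esym/H ->; rewrite addn0.
case: n => // n E; have := p_inf (ltn0Sn n).
by rewrite -(expVK m (p ^+ n.+1)) -exprD -E -[p ^+ m]mulr1 expVK eqxx.
Qed.

Lemma weighted0 L M : weighted L M 0.
Proof. by rewrite /weighted mulr0 mul0r !mulr0. Qed.

Lemma weightedD L M c d : weighted L M c -> weighted L M d -> weighted L M (c + d).
Proof. by rewrite /weighted !mulrDr !mulrDl => -> ->; rewrite mulrDr. Qed.

Lemma weighted_sum L M I (r : seq I) (P : pred I) (F : I -> A) :
  (forall i, P i -> weighted L M (F i)) -> weighted L M (\sum_(i <- r | P i) F i).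
Proof.
move=> H; elim/big_ind: _ => //; [exact: weighted0 | exact: weightedD].
Qed.

Lemma weighted_shift j L M c : weighted L M c -> weighted (L + j) (M + j) c.
Proof.
by rewrite /weighted => E; rewrite addnC [(M + j)%N]addnC !exprD -!mulrA E.
Qed.

Lemma weightedM L M L' M' c d :
  weighted L M c -> weighted L' M' d -> weighted (L + L') (M + M') (c * d).
Proof.
rewrite /weighted => E F; rewrite addnC !exprD -!mulrA [e * _]mulrA.
rewrite [p ^+ L * _]mulrA E -!mulrA [p ^+ L' * _]mulrA expC -!mulrA.
by congr (_ * _); rewrite [LHS]mulrA expC -mulrA F mulrA -expC !mulrA.
Qed.

Lemma weighted_comm c : e * c = c * e -> weighted 0 0 c.
Proof. by rewrite /weighted !mul1r. Qed.

Lemma wsum0 : wsum 0.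
Proof. by exists 0%N, 0; rewrite horner0; split=> // k; rewrite coef0; exact: weighted0. Qed.

Lemma wsum_weighted L M c : weighted L M c -> wsum c.
Proof.
move=> h; exists L, (c%:P * 'X^M); split.
  rewrite hornerM_comm; last by rewrite /comm_poly mulr1 mul1r.
  by rewrite hornerC hornerXn expr1n mulr1.
move=> k; rewrite coefCM coefXn; case: eqP => [->|_]; rewrite ?mulr1 ?mulr0 //.
exact: weighted0.
Qed.

Lemma horner1M (P Q : {poly A}) : (P * Q).[1] = P.[1] * Q.[1].
Proof. by rewrite hornerM_comm // /comm_poly mulr1 mul1r. Qed.

Lemma horner1MXn (P : {poly A}) n : (P * 'X^n).[1] = P.[1].
Proof. by rewrite horner1M hornerXn expr1n mulr1. Qed.

Lemma wsumD v w : wsum v -> wsum w -> wsum (v + w).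
Proof.
move=> [L [P [-> hP]]] [M [Q [-> hQ]]]; exists (L + M)%N, (P * 'X^M + Q * 'X^L).
rewrite hornerD !horner1MXn; split=> // k; rewrite coefD !coefMXn.
apply: weightedD; case: ltnP => le; try exact: weighted0.
  by rewrite -[X in weighted _ X _](subnK le); apply: weighted_shift.
by rewrite addnC -[X in weighted _ X _](subnK le); apply: weighted_shift.
Qed.

Lemma wsum_sum I (r : seq I) (F : I -> A) :
  (forall i, wsum (F i)) -> wsum (\sum_(i <- r) F i).
Proof. by move=> H; elim/big_ind: _ => //; [exact: wsum0|exact: wsumD]. Qed.

Lemma wsumM v w : wsum v -> wsum w -> wsum (v * w).
Proof.
move=> [L [P [-> hP]]] [M [Q [-> hQ]]]; exists (L + M)%N, (P * Q).
rewrite horner1M; split=> // k; rewrite coefM; apply: weighted_sum => i _.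
by rewrite -[X in weighted _ X _](subnKC (leq_ord i)); apply: weightedM.
Qed.

Lemma wsum_expV n w : wsum (p ^+ n * w) -> wsum w.
Proof.
move=> h; rewrite -(expVK n w); apply: wsumM => //.
by apply: wsum_weighted (weighted_comm _); rewrite expC'.
Qed.

Lemma wsum_exp n : wsum (e ^+ n).
Proof. by apply: wsum_weighted (weighted_comm _); rewrite -exprS -exprSr. Qed.

(* The elements of the localisation at [e], in terms of those of [A]. *)
Definition wlocal (w : A) : Prop :=
  (exists n, wsum (w * e ^+ n)) /\ (exists n, wsum (e ^+ n * w)).

Lemma wlocal_wsum w : wsum w -> wlocal w.
Proof. by split; exists 0%N; rewrite ?mulr1 ?mul1r. Qed.

Lemma wlocalD v w : wlocal v -> wlocal w -> wlocal (v + w).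
Proof.
move=> [[i hi] [i' hi']] [[j hj] [j' hj']]; split.
  exists (i + j)%N; rewrite mulrDl; apply: wsumD.
    by rewrite exprD mulrA; apply: wsumM (wsum_exp _).
  by rewrite addnC exprD mulrA; apply: wsumM (wsum_exp _).
exists (i' + j')%N; rewrite mulrDr; apply: wsumD.
  by rewrite addnC exprD -mulrA; apply: wsumM (wsum_exp _) _.
by rewrite exprD -mulrA; apply: wsumM (wsum_exp _) _.
Qed.

Lemma weighted_exp L M c n : weighted L M c ->
  p ^+ (L * n) * (e ^+ n * c) = p ^+ (M * n) * (c * e ^+ n).
Proof.
move=> E; elim: n => [|n IH]; first by rewrite !muln0 !mul1r mulr1.
rewrite !mulnS !exprD exprS.
have -> : p ^+ L * p ^+ (L * n) * (e * e ^+ n * c) =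
          p ^+ L * (e * (p ^+ (L * n) * (e ^+ n * c))).
  by rewrite -!mulrA; congr (_ * _); rewrite mulrA expC -!mulrA.
rewrite IH [e * _]mulrA -(expC _ e) -[_ * e * _]mulrA mulrA expC -mulrA.
by rewrite [e * _]mulrA [p ^+ L * _]mulrA E [RHS]mulrA -(expC (M * n)) -!mulrA.
Qed.

(** Split [w] times a power of [e] into homogeneous components. A further power of [e] passes each
    component at the cost of powers of [p] ([weighted_exp]) and reaches [v], where it clears the
    denominator. *)
Lemma wlocalM v w : wlocal v -> wlocal w -> wlocal (v * w).
Proof.
move=> [[i hi] [i' hi']] [[j hj] [j' hj']]; split.
  exists (j + i)%N; case: hj => L [P [EP hP]].
  rewrite exprD !mulrA -[v * w * _]mulrA EP horner_coef mulr_sumr mulr_suml.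
  apply: wsum_sum => k; rewrite expr1n mulr1; apply: (@wsum_expV (k * i)).
  rewrite mulrA [_ * (v * _)]mulrA expC -!mulrA -(weighted_exp i (hP k)).
  rewrite mulrA -expC -!mulrA; apply: wsumM; last rewrite mulrA.
    by apply: wsum_weighted (weighted_comm _); rewrite expC.
  by apply: wsumM => //; apply: wsum_weighted (hP k).
exists (j' + i')%N; case: hi' => L [P [EP hP]].
rewrite exprD -!mulrA [e ^+ i' * _]mulrA EP horner_coef mulr_suml mulr_sumr.
apply: wsum_sum => k; rewrite expr1n mulr1; apply: (@wsum_expV (L * j')).
rewrite [e ^+ j' * _]mulrA [p ^+ _ * _]mulrA (weighted_exp j' (hP k)).
rewrite -!mulrA; apply: wsumM.
  by apply: wsum_weighted (weighted_comm _); rewrite expC.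
by apply: wsumM => //; apply: wsum_weighted (hP k).
Qed.

(** Independence of eigenvectors: x |-> p^L e x - p^M x e kills the component of index 0 and turns
    that of index k into p^M (p^k - 1) c_k e, which vanishes only if c_k does. *)
Lemma weighted_direct L n M (c : nat -> A) :
  (forall k, weighted L (M + k) (c k)) -> \sum_(k < n) c k = 0 ->
  forall k, (k < n)%N -> c k = 0.
Proof.
elim: n M c => // n IH M c hc; rewrite big_ord_recl /= => S0.
have c1 k : (k < n)%N -> c k.+1 = 0.
  move=> kn; apply: (@mulf_eq0l (p ^+ k.+1 - 1)); last first.
    by rewrite subr_eq0 p_inf.
  apply: (IH M.+1 (fun k => (p ^+ k.+1 - 1) * c k.+1)) kn => [{}k|].
    rewrite addSnnS; have -> : L = (0 + L)%N by [].
    have -> : (M + k.+1 = 0 + (M + k.+1))%N by [].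
    apply: weightedM (hc _); apply: weighted_comm.
    by rewrite mulrBl mulrBr mulr1 mul1r expC.
  apply: (@mulf_eq0r _ e) => //; apply: (@mulf_eq0l (p ^+ M)); last first.
    by apply: dom_expf_neq0; apply/eqP => z; move: pV; rewrite z mul0r => /esym/eqP; rewrite oner_eq0.
  have /(congr1 (fun x => p ^+ L * (e * x) - p ^+ M * (x * e))) := S0.
  rewrite !(mulr0, mul0r) subr0 !(mulrDr, mulrDl) opprD addrACA.
  have := hc 0%N; rewrite /weighted addn0 => ->; rewrite subrr add0r => E; rewrite -[RHS]E.
  rewrite !mulr_sumr !mulr_suml !mulr_sumr -sumrB; apply: eq_bigr => i _.
  rewrite (hc i.+1) exprD /=.
  by rewrite mulrBl mul1r mulrBl mulrBr !mulrA.
move=> [|k] // kn; last exact: c1.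
by move: S0; rewrite big1 ?addr0 // => i _; rewrite /= c1.
Qed.

(** Vanishing low coefficients are divided out, each one raising [M] by 1. *)
Lemma wsum_normal w : wsum w -> w != 0 ->
  exists L M (P : {poly A}), [/\ w = P.[1], P`_0 != 0 &
    forall k, weighted L (M + k) P`_k].
Proof.
move=> [L [P [-> hP]]].
have {hP} : exists M, forall k, weighted L (M + k) P`_k by exists 0%N.
elim/poly_ind: P => [|P c IH] [M hP]; first by rewrite horner0 eqxx.
have [c0|c0] := eqVneq c 0; last first.
  exists L, M, (P * 'X + c%:P); split=> //.
  by rewrite coefD coefMX coefC /= add0r.
rewrite c0 addr0 -['X]expr1 horner1MXn; apply: IH; exists M.+1 => k.
by have := hP k.+1; rewrite coefD coefMX coefC /= addr0 addnS addSn.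
Qed.

(* Localising at [e] makes a domain of [A] graded by the weights, and units  *)
(* of a graded domain are homogeneous.                                        *)
Lemma unit_weighted u u' : u' * u = 1 -> wlocal u -> wlocal u' ->
  exists L M, weighted L M u.
Proof.
move=> uV [[n hn] _] [_ [m hm]].
have e0n k : e ^+ k != 0 by exact: dom_expf_neq0.
have u0 : u != 0 by apply/eqP => z; move/eqP: uV; rewrite z mulr0 eq_sym oner_eq0.
have u'0 : u' != 0.
  by apply/eqP => z; move/eqP: uV; rewrite z mul0r eq_sym oner_eq0.
have [|L [M [Q [EQ Q0 hQ]]]] := wsum_normal hn; first exact: dom_mulf_neq0.
have [|L' [M' [P [EP P0 hP]]]] := wsum_normal hm; first exact: dom_mulf_neq0.
(* e^(m+n) = (e^m u') (u e^n) has weight 0. In a domain the lowest and highest coefficients of [D]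
   are nonzero, so both have weight 0; hence [D], and with it [Q], is constant. *)
pose D := P * Q; pose E := e ^+ (m + n).
have DE : D.[1] = E.
  rewrite horner1M -EP -EQ /E exprD -!mulrA; congr (_ * _).
  by rewrite mulrA uV mul1r.
have hD k : weighted (L' + L) (M' + M + k) D`_k.
  rewrite coefM; apply: weighted_sum => i _.
  rewrite -{1}(subnKC (leq_ord i)) addnACA; exact: weightedM.
(* The degree of [D], sizes being degrees plus one. *)
pose s := (size P + size Q).-2.
have sP : (0 < size P)%N by rewrite size_poly_gt0; apply: contraNneq P0 => ->; rewrite coef0.
have sQ : (0 < size Q)%N by rewrite size_poly_gt0; apply: contraNneq Q0 => ->; rewrite coef0.
have sS : s.+2 = (size P + size Q)%N.
  by rewrite /s; case: (size P) sP => // a _; case: (size Q) sQ => // b _; rewrite addnS.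
have sD : (size D <= s.+1)%N by rewrite -[s.+1]/(s.+2.-1) sS size_polyMleq.
have D0 : D`_0 != 0 by rewrite coef0M dom_mulf_neq0.
have Ds : D`_s != 0.
  by rewrite -mul_lead_coef dom_mulf_neq0 ?lead_coef_eq0 -?size_poly_gt0.
(* [E] commutes with [e]; the component of index k is multiplied by the defect of its weight from
   0. *)
have hE : \sum_(k < s.+1) (p ^+ (M' + M + k) - p ^+ (L' + L)) * D`_k = 0.
  apply: (@mulf_eq0r _ e) => //.
  have : p ^+ (L' + L) * (e * D.[1]) = p ^+ (L' + L) * (D.[1] * e).
    by rewrite DE -exprS -exprSr.
  rewrite (horner_coef_wide _ sD).
  under eq_bigr do rewrite expr1n mulr1.
  move/eqP; rewrite -subr_eq0 => /eqP E0; rewrite -[RHS]E0.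
  rewrite !(mulr_sumr, mulr_suml) -sumrB; apply: eq_bigr => i _.
  by rewrite hD mulrBl mulrBl !mulrA.
have {}hE k : (k < s.+1)%N -> D`_k != 0 -> (M' + M + k = L' + L)%N.
  move=> ks Dk0; apply: expp_inj; apply/eqP; rewrite -subr_eq0; apply/eqP.
  apply: mulf_eq0r Dk0.
  apply: (@weighted_direct (L' + L) s.+1 (M' + M)
    (fun k => (p ^+ (M' + M + k) - p ^+ (L' + L)) * D`_k)) => // {ks}k.
  have := hD k; move: (D`_k) => c hc.
  have := weightedM (@weighted_comm (p ^+ (M' + M + k) - p ^+ (L' + L)) _) hc.
  by rewrite !add0n; apply; rewrite mulrBl mulrBr !expC.
have s0 : s = 0%N.
  have := hE s (ltnSn s) Ds; rewrite -(hE 0%N (ltn0Sn s) D0).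
  by move/addnI.
have sQ1 : (size Q <= 1)%N.
  by rewrite -(leq_add2l (size P)) -sS s0 addn1 ltnS.
exists L, M; have := hQ 0%N; move: EQ; rewrite (size1_polyC sQ1) hornerC coefC /=.
move=> <-; rewrite /weighted addn0 => h.
apply/eqP; rewrite -subr_eq0; apply/eqP; apply: (@mulf_eq0r _ (e ^+ n)) => //.
by rewrite mulrBl -!mulrA h -!mulrA -exprS -exprSr subrr.
Qed.
End Weights.

(** * Units q-commute with an element that grades the localisation *)

Section QCommuting.
Variables (K : fieldType) (A : algebra K).

Definition domain_alg : Prop :=
  (1 : A) != 0 /\ forall x y : A, x * y = 0 -> x = 0 \/ y = 0.

Hypothesis domA : domain_alg.
Variables (p : K) (e : A).
Hypotheses (p0 : p != 0) (p_inf : forall n, (0 < n)%N -> p ^+ n != 1).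
Hypothesis e0 : e != 0.

Definition qcommutes (c : A) : Prop :=
  exists L M, p ^+ L *: (e * c) = p ^+ M *: (c * e).

(** After inverting [e], such a [y] is homogeneous or a sum of two homogeneous elements. [wlocal]
    clears denominators on either side, hence two decompositions. *)
Definition local_generator (y : A) : Prop :=
  qcommutes y \/
  (exists a b, [/\ qcommutes a, qcommutes b & y * e = a + b]) /\
  (exists a b, [/\ qcommutes a, qcommutes b & e * y = a + b]).

Variables x1 x2 : A.
Hypothesis generated : forall P : A -> Prop,
  subalgebra P -> P x1 -> P x2 -> forall x, P x.
Hypotheses (x1P : local_generator x1) (x2P : local_generator x2).

Lemma unit_qcommutes u u' : u' * u = 1 -> qcommutes u.
Proof.
move=> uV.
have [nz dom] := domA.
(* [unit_weighted] is stated for nonzero rings with a central element p, so [A] is repackaged and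
   the scalar [p] is replaced by its image [sc p]. *)
pose A' : nzRingType := HB.pack (alg_sort A) (GRing.PzSemiRing_isNonZero.Build _ nz).
pose sc (c : K) : A' := c *: (1 : A).
have scE c (x : A') : sc c * x = c *: (x : A) :> A by rewrite /sc [LHS]algZl mul1r.
have scC c (x : A') : sc c * x = x * sc c.
  by rewrite [LHS]scE /sc [RHS]algZr mulr1.
have scX c n : sc c ^+ n = sc (c ^+ n).
  elim: n => [|n IH]; first by rewrite !expr0 /sc scale1r.
  by rewrite !exprS IH [LHS]scE /sc scalerA.
have sc_inj c d : sc c = sc d -> c = d.
  have [//|cd] := eqVneq c d; rewrite /sc => /eqP.
  rewrite -subr_eq0 -scalerBl => /eqP/(congr1 ( *:%R (c - d)^-1)).
  rewrite scalerA mulVf ?subr_eq0 // scale1r scaler0 => E.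
  by have /eqP[] := nz.
have weightedE (c : A') L M :
    @weighted A' e (sc p) L M c <-> p ^+ L *: (e * c : A) = p ^+ M *: (c * e : A).
  by rewrite /weighted !scX [LHS]scE [RHS]scE.
have pV : sc p * sc p^-1 = 1 by rewrite [LHS]scE /sc scalerA mulfV // scale1r.
have pinf n : (0 < n)%N -> sc p ^+ n != 1.
  move=> n0; rewrite scX; apply/eqP => E; have /eqP := p_inf n0; apply.
  by apply: sc_inj; rewrite E /sc scale1r.
pose loc : A' -> Prop := @wlocal A' e (sc p).
have qw (c : A') : qcommutes c -> @wsum A' e (sc p) c.
  by move=> [L [M /weightedE h]]; exact: wsum_weighted h.
have locG y : local_generator y -> loc y.
  case=> [/qw h|[[a [b [ha hb E]]] [a' [b' [ha' hb' E']]]]].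
    exact: wlocal_wsum.
  split; exists 1%N; rewrite expr1; first by rewrite [_ * _]E; apply: wsumD; apply: qw.
  by rewrite [_ * _]E'; apply: wsumD; apply: qw.
have locA : forall x, loc x.
  apply: generated; [split | exact: locG | exact: locG].
  - move=> c; apply: wlocal_wsum; apply: (@wsum_weighted A' e (sc p) 0 0).
    by apply: weighted_comm; exact: (esym (scC c e)).
  - by move=> x y; apply: wlocalD.
  - by move=> x y; apply: (wlocalM (scC p) (scC p^-1) pV).
have [] // := @unit_weighted A' e (sc p) (sc p^-1) dom (scC p) (scC p^-1) pV e0 pinf u u' uV
  (locA u) (locA u').
by move=> L [M /weightedE h]; exists L, M.
Qed.

End QCommuting.

(** * The relations of the primitive quotients *)

Section Relations.
Variables (K : fieldType) (q alpha b : K).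
Hypotheses (q0 : q != 0) (q_inf : forall n, (0 < n)%N -> q ^+ n != 1).
Hypotheses (alpha0 : alpha != 0) (b0 : b != 0).
Variables (A : algebra K) (x1 x2 x3 : A).

(** [x3] stands for e3, and x3 + (q^2 - q^-2) x2 x1 for its barred version. The last relation is z'
    = beta divided by 1 - q^-2. *)
Definition b2_relations : Prop :=
  [/\ x1 * x2 = q ^+ 2 *: (x2 * x1) + x3, x1 * x3 = q ^- 2 *: (x3 * x1),
      x2 * x3 = q ^+ 2 *: (x3 * x2) + alpha *: (1 : A) &
      x3 * (x3 + (q ^+ 2 - q ^- 2) *: (x2 * x1)) +
        ((1 + q ^- 2) * alpha) *: x1 = b *: (1 : A)].

Hypothesis rels : b2_relations.

Local Notation kap := (q ^+ 2 - q ^- 2).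
Local Notation g := ((1 + q ^- 2) * alpha).
Local Notation x3b := (x3 + kap *: (x2 * x1)).
(** The constant is the one that turns x2 x3 = q^2 x3 x2 + alpha into w x3 = q^2 x3 w. *)
Local Notation w := (x3 * x2 + (alpha / (q ^+ 2 - 1)) *: (1 : A)).

Let q2 : q ^+ 2 - 1 != 0. Proof. by rewrite subr_eq0 q_inf. Qed.
Let q4 : q ^+ 4 - 1 != 0. Proof. by rewrite subr_eq0 q_inf. Qed.

Let qq4 : (q * q) ^+ 2 - 1 != 0.
Proof. by rewrite -expr2 -exprM. Qed.

Let qq2 : q * q - 1 != 0. Proof. by rewrite -expr2. Qed.

Let kap0 : kap != 0.
Proof.
have q4E : q ^+ 4 - 1 = q ^+ 2 * kap by field.
by apply: contraNneq q4 => E; rewrite q4E E mulr0.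
Qed.

Let g0 : g != 0.
Proof.
have q4E : q ^+ 4 - 1 = (q ^+ 2 - 1) * q ^+ 2 * (1 + q ^- 2) by field.
by rewrite mulf_neq0 //; apply: contraNneq q4 => E; rewrite q4E E mulr0.
Qed.

Let sub0 (x y : A) : x = y -> x - y = 0. Proof. by move->; rewrite subrr. Qed.

Let d12 : x1 * x2 - (q ^+ 2 *: (x2 * x1) + x3) = 0.
Proof. by case: rels => /sub0. Qed.
Let d13 : x1 * x3 - q ^- 2 *: (x3 * x1) = 0.
Proof. by case: rels => _ /sub0. Qed.
Let d23 : x2 * x3 - (q ^+ 2 *: (x3 * x2) + alpha *: (1 : A)) = 0.
Proof. by case: rels => _ _ /sub0. Qed.
Let dz : x3 * x3b + g *: x1 - b *: (1 : A) = 0.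
Proof. by case: rels => _ _ _ /sub0. Qed.

Ltac nc := nc_ring K A [:: x1; x2; x3]; try by field.
(** The argument is a combination of the relators [d12], [d13], [d23], [dz] that equals the
    difference of the two sides in the free algebra. *)
Ltac nc_mod e :=
  apply/eqP; rewrite -subr_eq0; apply/eqP; transitivity e; [nc |
    rewrite ?d12 ?d13 ?d23 ?dz ?(mul0r, mulr0, scaler0, addr0, add0r)].

Lemma x3x1E : x3 * x1 = q ^+ 2 *: (x1 * x3).
Proof. by nc_mod (- (q ^+ 2 *: (x1 * x3 - q ^- 2 *: (x3 * x1)))); rewrite ?oppr0. Qed.

Lemma x1x3bE : x1 * x3b = q ^+ 2 *: (x3b * x1).
Proof.
nc_mod ((x1 * x3 - q ^- 2 *: (x3 * x1)) +
  kap *: ((x1 * x2 - (q ^+ 2 *: (x2 * x1) + x3)) * x1)) => //.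
Qed.

(** On a vector killed by [x3] this fixes the eigenvalue of [x1]. *)
Lemma x3bx3E : x3b * x3 = b *: (1 : A) - (q ^- 2 * g) *: x1.
Proof.
nc_mod (x3 * x3b + g *: x1 - b *: (1 : A) +
   kap *: (x2 * (x1 * x3 - q ^- 2 *: (x3 * x1))) +
   (kap * q ^- 2) *: ((x2 * x3 - (q ^+ 2 *: (x3 * x2) + alpha *: (1 : A))) * x1)) => //.
Qed.

(** Together with [x2x1E], this splits [x2], once [x1] is inverted, into components of opposite
    weights coming from [x3b] and [x3]. The analogous splitting for [x3] is [x3x2E] and [x2x3E],
    with components [w] and 1. *)
Lemma x1x2E : x1 * x2 = (kap^-1 * q ^+ 2) *: x3b + (- (kap^-1 * q ^- 2)) *: x3.
Proof.
nc_mod (x1 * x2 - (q ^+ 2 *: (x2 * x1) + x3)) => //.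
all: by field; rewrite ?q0 ?qq2 ?qq4.
Qed.

Lemma wx3E : w * x3 = q ^+ 2 *: (x3 * w).
Proof.
nc_mod (x3 * (x2 * x3 - (q ^+ 2 *: (x3 * x2) + alpha *: (1 : A)))) => //.
all: by field; rewrite ?q0 ?qq2 ?qq4.
Qed.

(** On a vector killed by [x1] this makes x3^2 act as [b]. *)
Lemma wx1E : kap *: (w * x1) = b *: (1 : A) - x3 * x3.
Proof.
nc_mod (x3 * x3b + g *: x1 - b *: (1 : A)) => //.
all: by field; rewrite ?q0 ?qq2 ?qq4.
Qed.

Lemma x2x1E : x2 * x1 = kap^-1 *: x3b + (- kap^-1) *: x3.
Proof.
nc_ring K A [:: x1; x2; x3]; by field; rewrite ?q0 ?qq2 ?qq4.
Qed.

Lemma x3x2E : x3 * x2 = w + (- (alpha / (q ^+ 2 - 1))) *: (1 : A).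
Proof. by rewrite scaleNr addrK. Qed.

Lemma x2x3E :
  x2 * x3 = q ^+ 2 *: w + (alpha - q ^+ 2 * (alpha / (q ^+ 2 - 1))) *: (1 : A).
Proof.
nc_mod (x2 * x3 - (q ^+ 2 *: (x3 * x2) + alpha *: (1 : A))) => //.
all: by field; rewrite ?q0 ?qq2 ?qq4.
Qed.

Let p_inf n : (0 < n)%N -> (q ^+ 2) ^+ n != 1.
Proof. by move=> n0; rewrite -exprM q_inf // muln_gt0. Qed.

Let p0 : q ^+ 2 != 0. Proof. exact: expf_neq0. Qed.

Let p_inj : injective (fun n => (q ^+ 2) ^+ n).
Proof.
apply: (@expp_inj K _ (q ^+ 2)^-1 _ _ p_inf) => [x|]; first by rewrite mulrC.
by rewrite mulfV.
Qed.

Hypothesis domA : domain_alg A.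
Hypothesis generated : forall P : A -> Prop,
  subalgebra P -> P x1 -> P x2 -> forall x, P x.

Let scale1_neq0 c : c != 0 -> c *: (1 : A) != 0.
Proof.
move=> c0; have [nz _] := domA; apply: contraNneq nz => E.
by rewrite -(scale1r (1 : A)) -(mulVf c0) -scalerA E scaler0.
Qed.

Lemma x3_neq0 : x3 != 0.
Proof.
case: rels => _ _ h23 _; apply: contraNneq (scale1_neq0 alpha0) => E.
by move: h23; rewrite E !(mulr0, mul0r) scaler0 add0r => <-.
Qed.

Lemma x1_neq0 : x1 != 0.
Proof.
case: rels => h12 _ _ _; apply: contraNneq x3_neq0 => E.
by move: h12; rewrite E !(mulr0, mul0r) scaler0 add0r => <-.
Qed.

Lemma qcommutesZ p (e : A) c d : qcommutes p e d -> qcommutes p e (c *: d).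
Proof.
move=> [L [M E]]; exists L, M.
by rewrite algZr algZl scalerA mulrC -scalerA E !scalerA mulrC.
Qed.

Lemma qcommutes1 p (e : A) : qcommutes p e 1.
Proof. by exists 0%N, 0%N; rewrite mul1r mulr1. Qed.

(** * Units are central *)

Section Unit.
Variables u u' : A.
Hypothesis Vu : u' * u = 1.

Lemma unit_qcommutes_x1 : qcommutes (q ^+ 2) x1 u.
Proof.
have q1 : qcommutes (q ^+ 2) x1 x1 by exists 0%N, 0%N.
have q3 : qcommutes (q ^+ 2) x1 x3.
  by exists 1%N, 0%N; rewrite expr0 scale1r expr1 x3x1E.
have q3b : qcommutes (q ^+ 2) x1 x3b.
  by exists 0%N, 1%N; rewrite expr0 scale1r expr1 x1x3bE.
apply: (unit_qcommutes domA p0 p_inf x1_neq0 generated _ _ Vu).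
  by left.
right; split.
  by rewrite x2x1E; do 2!eexists; split; [| |reflexivity]; exact: qcommutesZ.
by rewrite x1x2E; do 2!eexists; split; [| |reflexivity]; exact: qcommutesZ.
Qed.

Lemma unit_qcommutes_x3 : qcommutes (q ^+ 2) x3 u.
Proof.
have q1 : qcommutes (q ^+ 2) x3 x1.
  by exists 0%N, 1%N; rewrite expr0 scale1r expr1 x3x1E.
have qw : qcommutes (q ^+ 2) x3 w.
  by exists 1%N, 0%N; rewrite expr0 scale1r expr1 wx3E.
apply: (unit_qcommutes domA p0 p_inf x3_neq0 generated _ _ Vu).
  by left.
have qc c : qcommutes (q ^+ 2) x3 (c *: (1 : A)).
  by apply: qcommutesZ; exact: qcommutes1.
right; split.
  by rewrite x2x3E; do 2!eexists; split; [| |reflexivity]; [exact: qcommutesZ|].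
by rewrite x3x2E; do 2!eexists; split; [| |reflexivity].
Qed.

Variables (M : lmodType K) (rho rho' : action A M) (v v' : M) (s lambda : K).
Hypotheses (v0 : v != 0) (v'0 : v' != 0).
Hypotheses (rho1 : rho x1 v = 0) (rho3 : rho x3 v = s *: v).
Hypotheses (rho'3 : rho' x3 v' = 0) (rho'1 : rho' x1 v' = lambda *: v').
Hypotheses (s2 : s ^+ 2 = b) (lambdaE : lambda = q ^+ 2 * b / g).

Let unit_act_neq0 (tau : action A M) m : m != 0 -> tau u m != 0.
Proof.
apply: contraNneq => E.
by rewrite -(act1 tau m) -Vu actM E linear0.
Qed.

(* If [x1 u = c u x1] with [c] a power of [q ^+ 2] then on [u v'], as on [v'], *)
(* [x3] vanishes, and [x3b x3 = b - q ^- 2 g x1] forces [c = 1].                *)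
Lemma unit_comm_x1 : x1 * u = u * x1.
Proof.
have [L [N E1]] := unit_qcommutes_x1.
have [L' [N' E3]] := unit_qcommutes_x3.
have U0 := unit_act_neq0 rho' v'0.
have U3 : rho' x3 (rho' u v') = 0.
  have := congr1 (fun y => rho' y v') E3; rewrite /= !actZl !actM rho'3 linear0.
  rewrite scaler0 => /eqP; rewrite scaler_eq0 expf_eq0 (negPf p0) andbF /=.
  by move/eqP.
have U1 : (q ^+ 2) ^+ L *: rho' x1 (rho' u v') =
          ((q ^+ 2) ^+ N * lambda) *: rho' u v'.
  have := congr1 (fun y => rho' y v') E1; rewrite /= !actZl !actM rho'1 => ->.
  by rewrite linearZ_LR /= scalerA.
have := congr1 (fun y => (q ^+ 2) ^+ L *: rho' y (rho' u v')) x3bx3E.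
rewrite actM U3 linear0 scaler0 actBl !actZl act1 scalerBr.
rewrite [X in _ - X]scalerA mulrC -[X in _ - X]scalerA U1 !scalerA -scalerBl.
move/esym/eqP; rewrite scaler_eq0 (negPf U0) orbF.
have -> : q ^- 2 * g * ((q ^+ 2) ^+ N * lambda) = (q ^+ 2) ^+ N * b.
  by rewrite lambdaE; move: g0; move: g => G G0; field; rewrite ?q0 ?G0.
rewrite -mulrBl mulf_eq0 (negPf b0) orbF subr_eq0 => /eqP/p_inj LN.
by apply: (scalerI (expf_neq0 L p0)); rewrite E1 LN.
Qed.

(** Since [u] commutes with [x1], the vector u v is killed by [x1], so x3^2 acts on it as [b], just
    as on v. If x3 u = c u x3 this gives c^2 = 1, and c is a power of q^2, hence 1. *)
Lemma unit_comm_x3 : x3 * u = u * x3.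
Proof.
have [L [N E1]] := unit_qcommutes_x1.
have [L' [N' E3]] := unit_qcommutes_x3.
have U0 := unit_act_neq0 rho v0.
have U1 : rho x1 (rho u v) = 0.
  by rewrite -actM unit_comm_x1 actM rho1 linear0.
have U3 : (q ^+ 2) ^+ L' *: rho x3 (rho u v) = ((q ^+ 2) ^+ N' * s) *: rho u v.
  have := congr1 (fun y => rho y v) E3; rewrite /= !actZl !actM rho3 => ->.
  by rewrite linearZ_LR /= scalerA.
have := congr1 (fun y => rho y (rho u v)) wx1E.
rewrite actZl actM U1 linear0 scaler0 actBl actZl act1 actM => /esym/eqP.
rewrite subr_eq0 => /eqP E.
have : ((q ^+ 2) ^+ L' * (q ^+ 2) ^+ L' * b) *: rho u v =
       ((q ^+ 2) ^+ N' * (q ^+ 2) ^+ N' * b) *: rho u v.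
  rewrite -scalerA E (act_eigen2 U3).
  by congr (_ *: _); rewrite -s2; ring.
move/eqP; rewrite -subr_eq0 -scalerBl scaler_eq0 (negPf U0) orbF -mulrBl.
rewrite mulf_eq0 (negPf b0) orbF subr_eq0 -!exprD => /eqP/p_inj.
rewrite !addnn => /double_inj LN.
by apply: (scalerI (expf_neq0 L' p0)); rewrite E3 LN.
Qed.

(** Only [x2] is left. The z' relation writes x3 x2 x1 as a polynomial in [x1] and [x3], so it
    commutes with [u]; the outer factors then cancel in the domain. *)
Lemma unit_central y : y * u = u * y.
Proof.
apply: (generated (P := fun y => y * u = u * y)) y.
- split=> [c|y z hy hz|y z hy hz].
  + by rewrite algZl algZr mul1r mulr1.
  + by rewrite mulrDl hy hz mulrDr.
  + by rewrite -mulrA hz mulrA hy mulrA.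
- exact: unit_comm_x1.
have [_ dom] := domA.
have E : kap *: (x3 * x2 * x1) = b *: (1 : A) - g *: x1 - x3 * x3.
  case: rels => _ _ _ <-; nc_ring K A [:: x1; x2; x3]; by ring.
have : kap *: (x3 * (x2 * u - u * x2) * x1) = 0.
  have -> : x3 * (x2 * u - u * x2) * x1 = x3 * x2 * x1 * u - u * (x3 * x2 * x1).
    rewrite mulrBr mulrBl; congr (_ - _); last by rewrite !mulrA unit_comm_x3.
    by rewrite -!mulrA unit_comm_x1.
  rewrite scalerBr -algZl -(algZr _ u) E !(mulrBl, mulrBr) !algZl !algZr mul1r mulr1.
  by rewrite unit_comm_x1 -mulrA unit_comm_x3 mulrA unit_comm_x3 -mulrA subrr.
move/eqP; rewrite scaler_eq0 (negPf kap0) => /eqP/dom[/dom[]|] E0.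
- by move: x3_neq0; rewrite E0 eqxx.
- by apply/eqP; rewrite -subr_eq0 E0.
- by move: x1_neq0; rewrite E0 eqxx.
Qed.
End Unit.
End Relations.

(** * Highest weight modules *)

Section Table.
Variable K : fieldType.
Implicit Types (t : nat -> {poly K}) (p : {poly K}).

Definition table t p : {poly K} := \sum_(i < size p) p`_i *: t i.

Lemma table_wide n t p : (size p <= n)%N -> table t p = \sum_(i < n) p`_i *: t i.
Proof.
move=> le; rewrite /table (big_ord_widen n (fun i => p`_i *: t i)) //.
rewrite big_mkcond; apply: eq_bigr => i _; case: ltnP => // h.
by rewrite nth_default ?scale0r.
Qed.

Lemma table_linear t : linear (table t).
Proof.
move=> c p r; pose n := maxn (size p) (size r).
rewrite (@table_wide n _ p) ?leq_maxl // (@table_wide n _ r) ?leq_maxr //.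
rewrite (@table_wide n); last first.
  apply: leq_trans (size_polyD _ _) _; rewrite geq_max leq_maxr andbT.
  exact: leq_trans (size_scale_leq _ _) (leq_maxl _ _).
rewrite scaler_sumr -big_split; apply: eq_bigr => i _ /=.
by rewrite coefD coefZ scalerDl scalerA.
Qed.

Lemma tableXM t p : table t ('X * p) = table (fun k => t k.+1) p.
Proof.
rewrite (@table_wide (size p).+1); last first.
  by rewrite -commr_polyX (leq_trans (size_polyMleq _ _)) // size_polyX addn2.
rewrite big_ord_recl coefXM /= scale0r add0r.
by apply: eq_bigr => i _; rewrite coefXM.
Qed.

Lemma tableC t (c : K) : table t c%:P = c *: t 0%N.
Proof. by rewrite (@table_wide 1) ?size_polyC_leq1 // big_ord1 coefC. Qed.

End Table.

(** * Modules generated under e2 by a common eigenvector of e1 and e3 *)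

Section HighestWeight.
Variables (K : fieldType) (q alpha s lambda b : K) (M : lmodType K).
Variables (E1 E2 E3 : M -> M) (m0 : M).
Hypothesis q0 : q != 0.
Hypothesis E12 : forall m, E1 (E2 m) = q ^+ 2 *: E2 (E1 m) + E3 m.
Hypothesis E32 : forall m, E3 (E2 m) = q ^- 2 *: (E2 (E3 m) - alpha *: m).
Hypotheses (E1_0 : E1 m0 = lambda *: m0) (E3_0 : E3 m0 = s *: m0).
Hypothesis m0_ind : forall P : M -> Prop, P m0 ->
  (forall m, P m -> P (E2 m)) ->
  (forall c m n, P m -> P n -> P (c *: m + n)) -> forall m, P m.
(** What e1 e3 = q^-2 e3 e1 requires at [m0] when q^2 != 1. The next hypothesis is z' = beta at
    [m0], divided by 1 - q^-2. *)
Hypothesis sl : s * lambda = 0.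
Hypothesis bE : s ^+ 2 + q ^- 2 * ((1 + q ^- 2) * alpha) * lambda = b.

Variables (F : algebra K) (f1 f2 : F).

Local Notation f3 := (f1 * f2 - q ^+ 2 *: (f2 * f1)).
Local Notation f3b := (f1 * f2 - q ^- 2 *: (f2 * f1)).
Local Notation fz := (f2 * f3 - q ^+ 2 *: (f3 * f2)).

Variable rho : action F M.
Hypothesis hw_free1 : forall m, rho f1 m = E1 m.
Hypothesis hw_free2 : forall m, rho f2 m = E2 m.

Lemma hw_free3 m : rho f3 m = E3 m.
Proof.
rewrite actBl actZl !actM !hw_free1 !hw_free2 E12.
by rewrite addrAC subrr add0r.
Qed.

Lemma hw_freez m : rho fz m = alpha *: m.
Proof.
rewrite actBl actZl [rho (f2 * _) _]actM [rho (_ * f2) _]actM !hw_free3 !hw_free2.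
by rewrite E32 scalerA mulfV ?expf_neq0 // scale1r opprB addrC subrK.
Qed.

(** Because [m0] generates the module under [f2], an operator commuting with [f2] is determined at
    [m0]; each relation then needs checking on one vector only. *)
Lemma hw_scalar u d : (forall m, rho (u * f2) m = rho (f2 * u) m) ->
  rho u m0 = d *: m0 -> forall m, rho u m = d *: m.
Proof.
move=> comm u0; apply: m0_ind => // [m IH|c m n IHm IHn].
  by rewrite -hw_free2 -actM comm actM IH actZr.
by rewrite act_linearr IHm IHn scalerDr !scalerA mulrC.
Qed.

Ltac nc := nc_ring K F [:: f1; f2]; try by field.

(** The commutator of this element with [f2] is q^-2 (z f1 - f1 z), which acts as 0 because z acts
    as a scalar. *)
Lemma hw_free13 m : rho (f1 * f3 - q ^- 2 *: (f3 * f1)) m = 0.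
Proof.
rewrite -(scale0r m); move: m; apply: hw_scalar => [m|].
  have -> : (f1 * f3 - q ^- 2 *: (f3 * f1)) * f2 =
    f2 * (f1 * f3 - q ^- 2 *: (f3 * f1)) + q ^- 2 *: (fz * f1 - f1 * fz) by nc.
  rewrite actDl [X in _ + X]actZl [X in _ + _ *: X]actBl.
  by rewrite [rho (fz * _) _]actM [rho (_ * fz) _]actM !hw_freez actZr subrr scaler0 addr0.
rewrite actBl actZl [rho (f1 * _) _]actM [rho (_ * f1) _]actM !hw_free3 hw_free1.
rewrite ?hw_free1 E1_0 E3_0 -hw_free3 -hw_free1 !actZr hw_free3 hw_free1 E1_0 E3_0.
by rewrite [lambda *: (_ *: _)]scalerA [lambda * s]mulrC scalerA sl !scale0r scaler0 subrr.
Qed.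

Lemma hw_freez' m :
  rho (f3 * f3b + (1 + q ^- 2) *: (fz * f1)) m = b *: m.
Proof.
move: m; apply: hw_scalar => [m|].
  have -> : (f3 * f3b + (1 + q ^- 2) *: (fz * f1)) * f2 =
     f2 * (f3 * f3b + (1 + q ^- 2) *: (fz * f1)) +
     (q ^- 2 *: (fz * f3 - f3 * fz) +
      (1 + q ^- 2) *: ((fz * f2 - f2 * fz) * f1)) by nc.
  have zero u n : rho (fz * u - u * fz) n = 0.
    by rewrite actBl !actM !hw_freez actZr subrr.
  rewrite actDl [X in _ + X]actDl [X in _ + (X + _)]actZl zero.
  rewrite [X in _ + (_ + X)]actZl [X in _ + (_ + _ *: X)]actM zero.
  by rewrite !scaler0 !addr0.
have -> : f3b = f3 + (q ^+ 2 - q ^- 2) *: (f2 * f1) by nc.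
rewrite actDl actZl [rho (f3 * _) _]actM [rho (fz * _) _]actM hw_freez.
rewrite [rho (f3 + _) _]actDl [rho (_ *: _) _]actZl [rho (f2 * f1) _]actM.
rewrite hw_free1 E1_0 [X in X + _]linearD /= !hw_free3 E3_0 !actZr hw_free2.
rewrite -!hw_free3 !actZr !hw_free3 E3_0 E32 E3_0 -hw_free2 actZr.
rewrite !scalerBr !scalerA.
(* The coefficient of f2 m0, the only contribution off the line of [m0]. *)
have -> : (q ^+ 2 - q ^- 2) * lambda * q ^- 2 * s = 0.
  by rewrite mulrC !mulrA [s * _]mulrC -[_ * s * _]mulrA sl mulr0 mul0r.
rewrite scale0r sub0r -scaleNr -!scalerDl; congr (_ *: _); rewrite -bE.
by field.
Qed.

Lemma hw_serre1 m : rho (f1 ^+ 2 * f2 - (q ^+ 2 + q ^- 2) *: (f1 * f2 * f1) +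
  f2 * f1 ^+ 2) m = 0.
Proof.
have -> : f1 ^+ 2 * f2 - (q ^+ 2 + q ^- 2) *: (f1 * f2 * f1) + f2 * f1 ^+ 2 =
   f1 * f3 - q ^- 2 *: (f3 * f1) by rewrite !expr2; nc.
exact: hw_free13.
Qed.

(** The quartic Serre relator is q^-2 times the commutator of z and [f2]. *)
Lemma hw_serre2 (c := q ^+ 2 + 1 + q ^- 2) m :
  rho (f2 ^+ 3 * f1 - c *: (f2 ^+ 2 * f1 * f2) +
     c *: (f2 * f1 * f2 ^+ 2) - f1 * f2 ^+ 3) m = 0.
Proof.
have -> : f2 ^+ 3 * f1 - c *: (f2 ^+ 2 * f1 * f2) +
     c *: (f2 * f1 * f2 ^+ 2) - f1 * f2 ^+ 3 = q ^- 2 *: (fz * f2 - f2 * fz).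
  by rewrite /c !exprS !expr0 !mulr1; nc.
rewrite actZl actBl [rho (fz * _) _]actM [rho (_ * fz) _]actM !hw_freez.
by rewrite actZr subrr scaler0.
Qed.

End HighestWeight.

Section Verma.
Variables (K : fieldType) (q alpha s lambda : K).

(** Images of ['X^k] under e3, forced by e2 e3 - q^2 e3 e2 = alpha once e2 is multiplication by ['X]
    and 1 is an eigenvector. [verma_t1] comes likewise from e1 e2 = q^2 e2 e1 + e3. *)
Fixpoint verma_t3 (k : nat) : {poly K} :=
  if k is k'.+1 then q ^- 2 *: ('X * verma_t3 k' - alpha *: 'X^k') else s%:P.

Fixpoint verma_t1 (k : nat) : {poly K} :=
  if k is k'.+1 then q ^+ 2 *: ('X * verma_t1 k') + verma_t3 k' else lambda%:P.

Lemma table_t3X p : table verma_t3 ('X * p) =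
  q ^- 2 *: ('X * table verma_t3 p - alpha *: p).
Proof.
have pE : \sum_(i < size p) p`_i *: 'X^i = p by rewrite -poly_def coefK.
rewrite tableXM -[p in alpha *: p]pE /table /= mulr_sumr scaler_sumr -sumrB.
rewrite scaler_sumr; apply: eq_bigr => i _.
rewrite scalerA mulrC -scalerA; congr (_ *: _).
by rewrite scalerBr !scalerA [p`_i * _]mulrC scalerAr.
Qed.

Lemma table_t1X p : table verma_t1 ('X * p) =
  q ^+ 2 *: ('X * table verma_t1 p) + table verma_t3 p.
Proof.
rewrite tableXM /table /= mulr_sumr scaler_sumr -big_split; apply: eq_bigr => i _.
by rewrite /= scalerDr scalerA mulrC -scalerA scalerAr.
Qed.

End Verma.

(** * The quotient by z - alpha and z' - beta, and its modules *)

Section PrimitiveQuotient.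
Variables (K : fieldType) (q alpha beta : K).
Hypotheses (q0 : q != 0) (q_inf : forall n, (0 < n)%N -> q ^+ n != 1).

Local Notation A := (A_ q alpha beta).

Definition a1 : A := quot_pi _ (e1 q).
Definition a2 : A := quot_pi _ (e2 q).
Definition a3 : A := a1 * a2 - q ^+ 2 *: (a2 * a1).

Local Notation F := (Defs.free K 'I_2).

Lemma A_ind (P : A -> Prop) : subalgebra P -> P a1 -> P a2 -> forall x, P x.
Proof.
move=> sP P1 P2 x.
have [y ->] := quot_pi_surj x; have [u ->] := quot_pi_surj y.
apply: (free_ind (P := fun u => P (quot_pi _ (quot_pi _ u)))) u.
  exact: (subalgebra_pi (P := fun y => P (quot_pi _ y)) (subalgebra_pi sP)).
case=> [[|[|//]] i2].
  by rewrite (_ : Ordinal i2 = ord0) //; apply: val_inj.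
by rewrite (_ : Ordinal i2 = ord_max) //; apply: val_inj.
Qed.

Let b := beta / (1 - q ^- 2).

Let q2 : 1 - q ^- 2 != 0.
Proof.
have := q_inf (n := 2) isT; apply: contraNneq => E.
have -> : q ^+ 2 = q ^+ 2 * (1 - q ^- 2) + 1 by field.
by rewrite E mulr0 add0r.
Qed.

Lemma Uq_e1e3 : e1 q * e3 q = q ^- 2 *: (e3 q * e1 q).
Proof.
pose f1 : F := free_gen K ord0; pose f2 : F := free_gen K ord_max.
have -> : e3 q = quot_pi (serre_relator q) (f1 * f2 - q ^+ 2 *: (f2 * f1)).
  exact: (esym (quot_pi_qcomm _ _ _ _ _ _)).
rewrite -[LHS]quot_piM -[_ * _ in RHS]quot_piM -[RHS]quot_piZ; apply: quot_pi_rel; left.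
rewrite !expr2 -/f1 -/f2; move: f1 f2 => f1 f2.
nc_ring K (Defs.free K 'I_2) [:: f1; f2]; try by field.
Qed.

Lemma b2_rel_z' (B : algebra K) (x1 x2 : B) (x3 := x1 * x2 - q ^+ 2 *: (x2 * x1)) :
  beta *: (1 : B) = (1 - q ^- 2) *: (x3 * (x1 * x2 - q ^- 2 *: (x2 * x1)) +
    (1 + q ^- 2) *: (alpha *: x1)) ->
  x3 * (x3 + (q ^+ 2 - q ^- 2) *: (x2 * x1)) + ((1 + q ^- 2) * alpha) *: x1 =
    b *: (1 : B).
Proof.
move=> E; apply: (scalerI q2).
rewrite [RHS]scalerA /b mulrCA mulfV // mulr1 E /x3.
nc_ring K B [:: x1; x2]; by field.
Qed.

Lemma A_relations : b2_relations q alpha b a1 a2 a3.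
Proof.
pose S (u : Uq q) := u = z q - alpha *: (1 : Uq q) \/ u = z' q - beta *: (1 : Uq q).
pose pi := quot_pi S.
have a3E : a3 = pi (e3 q) by exact: (esym (quot_pi_qcomm _ _ _ _ _ _)).
have zE : pi (z q) = alpha *: (1 : A).
  transitivity (pi (alpha *: (1 : Uq q))); last exact: quot_piZ.
  by apply: quot_pi_rel; left.
have z'E : pi (z' q) = beta *: (1 : A).
  transitivity (pi (beta *: (1 : Uq q))); last exact: quot_piZ.
  by apply: quot_pi_rel; right.
have ez : a2 * a3 - q ^+ 2 *: (a3 * a2) = alpha *: (1 : A).
  by rewrite -zE a3E; exact: (esym (quot_pi_qcomm _ _ _ _ _ _)).
have subE (V : zmodType) (x y : V) : x = y + (x - y) by rewrite addrC subrK.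
split.
- exact: subE.
- by rewrite a3E -[LHS]quot_piM Uq_e1e3 -[_ * _ in RHS]quot_piM; exact: quot_piZ.
- rewrite -ez; exact: subE.
have e3bE : pi (e3bar q) = a1 * a2 - q ^- 2 *: (a2 * a1).
  exact: quot_pi_qcomm.
have z'E2 := quot_pi_scaled_sum S (1 - q ^- 2) (1 + q ^- 2) (e3 q) (e3bar q) (z q) (e1 q).
have E : beta *: (1 : A) = (1 - q ^- 2) *: (a3 * (a1 * a2 - q ^- 2 *: (a2 * a1)) +
    (1 + q ^- 2) *: (alpha *: a1)).
  apply: etrans (esym z'E) _; apply: etrans z'E2 _.
  apply: (congr1 ( *:%R (1 - q ^- 2))); apply: (congr2 +%R).
    by apply: (congr2 *%R); [exact: esym a3E | exact: e3bE].
  apply: (congr1 ( *:%R (1 + q ^- 2))).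
  apply: etrans (congr1 (fun y : A => y * a1) zE) _.
  exact: etrans (algZl _ _ _) (congr1 ( *:%R alpha) (mul1r a1)).
exact: b2_rel_z' E.
Qed.

(** The module is [{poly K}], free of rank one over the polynomials in e2, with highest weight
    vector 1. *)
Lemma A_verma (s lambda : K) : s * lambda = 0 ->
  s ^+ 2 + q ^- 2 * ((1 + q ^- 2) * alpha) * lambda = b ->
  exists tau : action A {poly K}, exists2 v : {poly K}, v != 0 &
    tau a1 v = lambda *: v /\ tau a3 v = s *: v.
Proof.
move=> sl bE.
pose op (i : 'I_2) (p : {poly K}) : {poly K} :=
  if i == ord0 then table (verma_t1 q alpha s lambda) p else 'X * p.
have op_lin i : linear (op i).
  move=> c p r; rewrite /op; case: ifP => _; first exact: table_linear.
  by rewrite mulrDr scalerAr.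
pose rho := free_action op_lin.
pose f1 : F := free_gen K ord0; pose f2 : F := free_gen K ord_max.
have r1 m : rho f1 m = table (verma_t1 q alpha s lambda) m by exact: free_action_gen.
have r2 m : rho f2 m = 'X * m by exact: free_action_gen.
have ind (P : {poly K} -> Prop) : P 1 -> (forall m, P m -> P ('X * m)) ->
    (forall c m n, P m -> P n -> P (c *: m + n)) -> forall m, P m.
  move=> P1 PX PD; elim/poly_ind=> [|p c Pp].
    by rewrite -(addNr 1) -scaleN1r; exact: PD.
  by rewrite addrC commr_polyX -[c%:P]mulr1 mul_polyC; apply: PD => //; apply: PX.
have t30 : table (verma_t3 q alpha s) 1 = s *: 1.
  by rewrite -[1]/(1%:P) tableC scale1r /= -mul_polyC mulr1.
have t10 : table (verma_t1 q alpha s lambda) 1 = lambda *: 1.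
  by rewrite -[1]/(1%:P) tableC scale1r /= -mul_polyC mulr1.
have S1 := hw_serre1 q0 (table_t1X q alpha s lambda) (table_t3X q alpha s) t10 t30 ind sl r1 r2.
have S2 := hw_serre2 q0 (table_t1X q alpha s lambda) (table_t3X q alpha s) r1 r2.
have Sz := hw_freez q0 (table_t1X q alpha s lambda) (table_t3X q alpha s) r1 r2.
have Sz' := hw_freez' q0 (table_t1X q alpha s lambda) (table_t3X q alpha s) t10 t30 ind sl bE r1 r2.
have S3 := hw_free3 (table_t1X q alpha s lambda) r1 r2.
have serre u : serre_relator q u -> forall m, rho u m = 0.
  by case=> -> m; [exact: S1 | exact: S2].
pose rho1 : action (Uq q) {poly K} := quot_action serre.
have rel (u : Uq q) : u = z q - alpha *: (1 : Uq q) \/ u = z' q - beta *: (1 : Uq q) ->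
    forall m, rho1 u m = 0.
  have ez (c : K) v m : rho1 v m = c *: m -> rho1 (v - c *: (1 : Uq q)) m = 0.
    by move=> E; rewrite actBl actZl act1 E subrr.
  have e3E : e3 q = quot_pi (serre_relator q) (f1 * f2 - q ^+ 2 *: (f2 * f1)).
    exact: (esym (quot_pi_qcomm _ _ _ _ _ _)).
  have e3bE : e3bar q = quot_pi (serre_relator q) (f1 * f2 - q ^- 2 *: (f2 * f1)).
    exact: (esym (quot_pi_qcomm _ _ _ _ _ _)).
  have zE : z q = quot_pi (serre_relator q) (f2 * (f1 * f2 - q ^+ 2 *: (f2 * f1)) -
          q ^+ 2 *: ((f1 * f2 - q ^+ 2 *: (f2 * f1)) * f2)).
    by apply: etrans (esym (quot_pi_qcomm _ _ _ _ _ _)); rewrite -e3E.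
  have z'E : z' q = quot_pi (serre_relator q) ((1 - q ^- 2) *:
      ((f1 * f2 - q ^+ 2 *: (f2 * f1)) * (f1 * f2 - q ^- 2 *: (f2 * f1)) +
       (1 + q ^- 2) *: ((f2 * (f1 * f2 - q ^+ 2 *: (f2 * f1)) -
          q ^+ 2 *: ((f1 * f2 - q ^+ 2 *: (f2 * f1)) * f2)) * f1))).
    apply: etrans (esym (quot_pi_scaled_sum _ _ _ _ _ _ _)).
    apply: (congr1 ( *:%R (1 - q ^- 2))); apply: (congr2 +%R).
      exact: (congr2 *%R e3E e3bE).
    exact: (congr1 ( *:%R (1 + q ^- 2)) (congr1 (fun y : Uq q => y * e1 q) zE)).
  case=> -> m; apply: ez; first by rewrite zE; exact: etrans (quot_actionE _ _ _) (Sz m).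
  rewrite z'E; apply: etrans (quot_actionE _ _ _) _.
  apply: etrans (actZl _ _ _ _) _; apply: etrans (congr1 _ (Sz' m)) _.
  by rewrite scalerA /b mulrCA mulfV // mulr1.
pose tau : action A {poly K} := quot_action rel.
exists tau, 1; first exact: oner_neq0.
have tE u m : tau (quot_pi _ (quot_pi _ u)) m = rho u m.
  exact: etrans (quot_actionE _ _ _) (quot_actionE _ _ _).
split; first by apply: etrans (tE f1 1) _; rewrite r1.
have a3E : a3 = quot_pi _ (quot_pi _ (f1 * f2 - q ^+ 2 *: (f2 * f1))).
  apply: esym; apply: etrans (congr1 _ (quot_pi_qcomm _ _ _ _ _ _)) _.
  exact: quot_pi_qcomm.
by rewrite a3E; apply: etrans (tE _ 1) _; rewrite S3.
Qed.

End PrimitiveQuotient.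

(** * Generalized Weyl algebras *)

Section GwaGenerators.
Variables (K : fieldType) (R : algType K).
Variables (sigma : {lrmorphism R -> R}) (sigma' : R -> R) (a : R).

Local Notation G := (gwa sigma sigma' a).
Local Notation S := (gwa_relator sigma sigma' a).

Definition gwa_r (r : R) : G := quot_pi S (free_gen K (inl r : (R + bool)%type)).
Definition gwa_x : G := quot_pi S (free_gen K (inr true : (R + bool)%type)).
Definition gwa_y : G := quot_pi S (free_gen K (inr false : (R + bool)%type)).

Lemma gwa_rD r s : gwa_r (r + s) = gwa_r r + gwa_r s.
Proof. exact: etrans (quot_pi_rel (GwaD _ _ _ r s)) (quot_piD _ _ _). Qed.

Lemma gwa_rZ c r : gwa_r (c *: r) = c *: gwa_r r.
Proof. exact: etrans (quot_pi_rel (GwaZ _ _ _ c r)) (quot_piZ _ _ _). Qed.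

Lemma gwa_r1 : gwa_r 1 = 1.
Proof. exact: quot_pi_rel (Gwa1 _ _ _). Qed.

Lemma gwa_rM r s : gwa_r (r * s) = gwa_r r * gwa_r s.
Proof. exact: etrans (quot_pi_rel (GwaM _ _ _ r s)) (quot_piM _ _ _). Qed.

Lemma gwa_r0 : gwa_r 0 = 0.
Proof. by rewrite -(scale0r (0 : R)) gwa_rZ scale0r. Qed.

Lemma gwa_xr r : gwa_x * gwa_r r = gwa_r (sigma r) * gwa_x.
Proof.
exact: etrans (esym (quot_piM _ _ _))
  (etrans (quot_pi_rel (GwaX _ _ _ r)) (quot_piM _ _ _)).
Qed.

Lemma gwa_yr r : gwa_y * gwa_r r = gwa_r (sigma' r) * gwa_y.
Proof.
exact: etrans (esym (quot_piM _ _ _))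
  (etrans (quot_pi_rel (GwaY _ _ _ r)) (quot_piM _ _ _)).
Qed.

Lemma gwa_xy : gwa_x * gwa_y = gwa_r (sigma a).
Proof. exact: etrans (esym (quot_piM _ _ _)) (quot_pi_rel (GwaXY _ _ _)). Qed.

Lemma gwa_yx : gwa_y * gwa_x = gwa_r a.
Proof. exact: etrans (esym (quot_piM _ _ _)) (quot_pi_rel (GwaYX _ _ _)). Qed.

Lemma gwa_ind (P : G -> Prop) : subalgebra P -> (forall r, P (gwa_r r)) ->
  P gwa_x -> P gwa_y -> forall g, P g.
Proof.
move=> sP Pr Px Py g; have [u ->] := quot_pi_surj g.
apply: (free_ind (P := fun u => P (quot_pi _ u)) (subalgebra_pi sP)) u.
case=> [r|[|]]; [exact: Pr | exact: Px | exact: Py].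
Qed.

Lemma gwa_action (M : lmodType K) (opr : R -> M -> M) (opx opy : M -> M) :
  (forall r, linear (opr r)) -> linear opx -> linear opy ->
  (forall m, linear (opr^~ m)) -> (forall m, opr 1 m = m) ->
  (forall r s m, opr (r * s) m = opr r (opr s m)) ->
  (forall r m, opx (opr r m) = opr (sigma r) (opx m)) ->
  (forall r m, opy (opr r m) = opr (sigma' r) (opy m)) ->
  (forall m, opx (opy m) = opr (sigma a) m) -> (forall m, opy (opx m) = opr a m) ->
  exists tau : action G M, [/\ forall r m, tau (gwa_r r) m = opr r m,
    forall m, tau gwa_x m = opx m & forall m, tau gwa_y m = opy m].
Proof.
move=> lr lx ly ll o1 oM oxr oyr oxy oyx.
pose op (i : (R + bool)%type) (m : M) : M :=
  match i with inl r => opr r m | inr b => if b then opx m else opy m end.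
have op_lin i : linear (op i).
  by case: i => [r|[|]]; [exact: lr | exact: lx | exact: ly].
pose rho := free_action op_lin.
have rg i m : rho (free_gen K i) m = op i m by exact: free_action_gen.
have rD i j m : rho (free_gen K i + free_gen K j) m = op i m + op j m.
  by rewrite actDl !rg.
have rM i j m : rho (free_gen K i * free_gen K j) m = op i (op j m).
  by rewrite actM !rg.
have rZ c i m : rho (c *: free_gen K i) m = c *: op i m by rewrite actZl rg.
have eq0 u w m c d : rho u m = c -> rho w m = d -> c = d -> rho (u - w) m = 0.
  by move=> <- <- E; rewrite actBl E subrr.
have rel u : S u -> forall m, rho u m = 0.
  case=> [r s|c r||r s|r|r||] m.
  - apply: eq0 (rg _ _) (rD _ _ _) _.
    by have := ll m 1 r s; rewrite !scale1r.
  - apply: eq0 (rg _ _) (rZ _ _ _) _.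
    have := ll m c r 0; rewrite addr0 => /= ->.
    by have := ll m (-1) r r; rewrite !scaleN1r !addNr => ->; rewrite addr0.
  - exact: eq0 (rg (inl 1) m) (act1 rho m) (o1 m).
  - exact: eq0 (rg (inl (r * s)) m) (rM (inl r) (inl s) m) (oM r s m).
  - exact: eq0 (rM (inr true) (inl r) m) (rM (inl (sigma r)) (inr true) m) (oxr r m).
  - exact: eq0 (rM (inr false) (inl r) m) (rM (inl (sigma' r)) (inr false) m) (oyr r m).
  - exact: eq0 (rM (inr true) (inr false) m) (rg (inl (sigma a)) m) (oxy m).
  - exact: eq0 (rM (inr false) (inr true) m) (rg (inl a) m) (oyx m).
exists (quot_action rel).
by split=> [r m|m|m]; apply: etrans (quot_actionE _ _ _) _; rewrite rg.
Qed.

End GwaGenerators.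

(** * Normal forms and top coefficients *)

Section GwaDomain.
Variables (K : fieldType) (R : algType K).
Variables (sigma : {lrmorphism R -> R}) (sigma' : R -> R) (a : R).
Hypotheses (sK : cancel sigma sigma') (s'K : cancel sigma' sigma).
Hypotheses (a0 : a != 0) (aC : forall r, a * r = r * a).

Local Notation G := (gwa sigma sigma' a).
Local Notation gr := (@gwa_r K R sigma sigma' a).
Local Notation gx := (@gwa_x K R sigma sigma' a).
Local Notation gy := (@gwa_y K R sigma sigma' a).

Let M : lmodType K := (int -> R : Type).

(* [R(sigma, a)] embeds into the skew Laurent ring R[S, S^-1; sigma] by       *)
(* x |-> S, y |-> a S^-1; here this ring acts on functions, which keeps the   *)
(* action faithful on R[S, S^-1; sigma] even when sigma has finite order.     *)
Lemma gwa_shift_action : exists tau : action G M,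
  [/\ forall r m n, tau (gr r) m n = r * m n,
      forall m n, tau gx m n = sigma (m (n - 1)) &
      forall m n, tau gy m n = a * sigma' (m (n + 1))].
Proof.
have sl' : linear sigma'.
  by move=> c r s; apply: (can_inj sK); rewrite s'K linearD linearZ_LR /= !s'K.
have sM' (r s : R) : sigma' (r * s) = sigma' r * sigma' s.
  by apply: (can_inj sK); rewrite (s'K (r * s)) rmorphM /= !s'K.
have [] := @gwa_action K R sigma sigma' a M (fun r m n => r * m n)
  (fun m n => sigma (m (n - 1))) (fun m n => a * sigma' (m (n + 1))).
- move=> r c m m'; apply/funext => n.
  change (r * (c *: m n + m' n) = c *: (r * m n) + r * m' n).
  by rewrite mulrDr scalerAr.
- move=> c m m'; apply/funext => n.
  change (sigma (c *: m (n - 1) + m' (n - 1)) =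
          c *: sigma (m (n - 1)) + sigma (m' (n - 1))).
  by rewrite linearD linearZ_LR.
- move=> c m m'; apply/funext => n.
  change (a * sigma' (c *: m (n + 1) + m' (n + 1)) =
          c *: (a * sigma' (m (n + 1))) + a * sigma' (m' (n + 1))).
  by rewrite sl' mulrDr scalerAr.
- move=> m c r s; apply/funext => n.
  change ((c *: r + s) * m n = c *: (r * m n) + s * m n).
  by rewrite mulrDl scalerAl.
- by move=> m; apply/funext => n; rewrite mul1r.
- by move=> r s m; apply/funext => n; rewrite mulrA.
- by move=> r m; apply/funext => n; rewrite rmorphM.
- by move=> r m; apply/funext => n; rewrite sM' !mulrA aC.
- by move=> m; apply/funext => n; rewrite rmorphM /= s'K subrK.
- by move=> m; apply/funext => n; rewrite sK addrK.
by move=> tau [h1 h2 h3]; exists tau; split=> *; rewrite (h1, h2, h3).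
Qed.

(** Additivity is not assumed: [v] will be the leading coefficient on K[h] and the indicator of
    nonzero elements on K[h, h^-1]. *)
Variable v : R -> K.
Hypotheses (vM : forall r s, v (r * s) = v r * v s) (v1 : v 1 = 1).
Hypotheses (v0 : forall r, (v r == 0) = (r == 0)) (vs : forall r, v (sigma r) = v r).

Variable tau : action G M.
Hypothesis tau_r : forall r m n, tau (gr r) m n = r * m n.
Hypothesis tau_x : forall m n, tau gx m n = sigma (m (n - 1)).
Hypothesis tau_y : forall m n, tau gy m n = a * sigma' (m (n + 1)).

Let v00 : v 0 = 0. Proof. by apply/eqP; rewrite v0. Qed.

Let vs' r : v (sigma' r) = v r. Proof. by rewrite -[in RHS](s'K r) vs. Qed.

Definition supp_le (k : int) (m : M) : Prop := forall n, k < n -> m n = 0.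

(** Seen through [v], [g] acts at the upper edge of supports like a homogeneous element of degree
    [N] with coefficient [rho]. Quantifying over every bound [k] makes this compose ([topM]). *)
Definition top (N : int) (rho : K) (g : G) : Prop := forall k m, supp_le k m ->
  supp_le (k + N) (tau g m) /\ v (tau g m (k + N)) = rho * v (m k).

Lemma topM N N' rho rho' g g' :
  top N rho g -> top N' rho' g' -> top (N + N') (rho * rho') (g * g').
Proof.
move=> h h' k m /h' [/h [s E] E']; rewrite actM [N + N']addrC addrA; split=> //.
by rewrite E E' mulrA.
Qed.

Lemma top_r r : top 0 (v r) (gr r).
Proof.
move=> k m sm; rewrite addr0; split=> [n kn|]; last by rewrite tau_r vM.
by rewrite tau_r sm // mulr0.
Qed.

Lemma top_x : top 1 1 gx.
Proof.
move=> k m sm; split=> [n kn|]; last by rewrite tau_x vs addrK mul1r.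
by rewrite tau_x sm ?linear0 //; lia.
Qed.

Lemma top_y : top (-1) (v a) gy.
Proof.
move=> k m sm; split=> [n kn|]; last by rewrite tau_y vM vs' subrK.
rewrite tau_y sm; last by lia.
suff -> : sigma' 0 = 0 by rewrite mulr0.
by apply: (can_inj sK); rewrite s'K linear0.
Qed.

Definition gwa_w (j : int) : G :=
  match j with Posz k => gx ^+ k | Negz k => gy ^+ k.+1 end.

Lemma top_w j : exists2 rho, rho != 0 & top j rho (gwa_w j).
Proof.
have H N r0 g : r0 != 0 -> top N r0 g ->
    forall n, exists2 rho, rho != 0 & top (n%:Z * N) rho (g ^+ n).
  move=> r00 tg; elim=> [|n [rho rho0 IH]].
    exists 1; rewrite ?oner_neq0 // mul0r => k m sm.
    by rewrite addr0 expr0 act1 mul1r.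
  exists (r0 * rho); first by rewrite mulf_neq0.
  have -> : n.+1%:Z * N = N + n%:Z * N by rewrite intS mulrDl mul1r.
  by rewrite exprS; exact: topM.
case: j => k; first by have := H _ _ _ (oner_neq0 K) top_x k; rewrite mulr1.
have va0 : v a != 0 by rewrite v0.
by have := H _ _ _ va0 top_y k.+1; rewrite NegzE mulrN1.
Qed.

(** Left R-combinations of the [gwa_w j] with -L <= j < n - L, the highest degree being peeled off
    first. *)
Fixpoint gwa_fil (L n : nat) (g : G) : Prop :=
  if n is n'.+1 then exists r g', gwa_fil L n' g' /\
      g = gr r * gwa_w (n'%:Z - L%:Z) + g'
  else g = 0.

Lemma gwa_filS L n g : gwa_fil L n g -> gwa_fil L n.+1 g.
Proof. by move=> h; exists 0, g; rewrite gwa_r0 mul0r add0r. Qed.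

Lemma gwa_fil_le L n n' g : (n <= n')%N -> gwa_fil L n g -> gwa_fil L n' g.
Proof.
move=> /subnKC <- h; elim: (n' - n)%N => [|d IH]; first by rewrite addn0.
by rewrite addnS; exact: gwa_filS.
Qed.

Lemma gwa_fil0 L n : gwa_fil L n 0.
Proof. exact: (@gwa_fil_le L 0). Qed.

Lemma gwa_filD L n g h : gwa_fil L n g -> gwa_fil L n h -> gwa_fil L n (g + h).
Proof.
elim: n g h => [|n IH] g h /=; first by move=> -> ->; rewrite addr0.
move=> [r [g' [hg ->]]] [s [h' [hh ->]]]; exists (r + s), (g' + h').
by split; [exact: IH | rewrite gwa_rD mulrDl addrACA].
Qed.

Lemma gwa_fil_shift d L n g : gwa_fil L n g -> gwa_fil (L + d) (n + d) g.
Proof.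
elim: n g => [|n IH] g /=; first by move=> ->; exact: gwa_fil0.
move=> [r [g' [/IH h ->]]]; exists r, g'; split; first exact: h.
have -> // : (n + d)%N%:Z - (L + d)%N%:Z = n%:Z - L%:Z by lia.
Qed.

Definition gwa_nf (g : G) : Prop := exists L n, gwa_fil L n g.

Lemma gwa_nfD g h : gwa_nf g -> gwa_nf h -> gwa_nf (g + h).
Proof.
move=> [L [n hg]] [L' [n' hh]]; exists (L + L')%N, (maxn (n + L') (n' + L)).
apply: gwa_filD.
  by apply: gwa_fil_le (leq_maxl _ _) _; exact: gwa_fil_shift.
by rewrite addnC; apply: gwa_fil_le (leq_maxr _ _) _; exact: gwa_fil_shift.
Qed.

Lemma gwa_nf_w r j : gwa_nf (gr r * gwa_w j).
Proof.
case: j => k.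
  exists 0%N, k.+1, r, 0; split; first exact: gwa_fil0.
  by rewrite subr0 addr0.
exists k.+1, 1%N, r, 0; split=> //; rewrite addr0.
have -> // : 0%N%:Z - k.+1%:Z = Negz k by lia.
Qed.

Lemma gwa_x_w j : exists t, gx * gwa_w j = gr t * gwa_w (j + 1).
Proof.
case: j => [k|[|k]].
- by exists 1; rewrite gwa_r1 mul1r -exprS -[k%:Z + 1]/((k + 1)%N%:Z) addn1.
- by exists (sigma a); rewrite [gwa_w _]expr1 gwa_xy mulr1.
exists (sigma a); rewrite [gwa_w (Negz _)]exprS mulrA gwa_xy.
have -> // : Negz k.+1 + 1 = Negz k by lia.
Qed.

Lemma gwa_y_w j : exists t, gy * gwa_w j = gr t * gwa_w (j - 1).
Proof.
case: j => [[|k]|k].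
- by exists 1; rewrite gwa_r1 mul1r [RHS]expr1 mulr1.
- exists a; rewrite [gwa_w (Posz k.+1)]exprS mulrA gwa_yx.
  have -> // : k.+1%:Z - 1 = k%:Z by lia.
exists 1; rewrite gwa_r1 mul1r -exprS.
have -> // : Negz k - 1 = Negz k.+1 by lia.
Qed.

(** The R-combinations of powers of x and y contain 1 and are stable under left multiplication by
    each generator. *)
Lemma gwa_nfP g : gwa_nf g.
Proof.
have nf1 : gwa_nf (1 : G).
  by have := gwa_nf_w 1 0; rewrite gwa_r1 mul1r -[gwa_w 0]/(1 : G).
suff H h : gwa_nf h -> gwa_nf (g * h) by rewrite -(mulr1 g); exact: H.
suff nf_mul u : (forall r j, gwa_nf (u * (gr r * gwa_w j))) ->
    forall h, gwa_nf h -> gwa_nf (u * h).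
  have nf_r s h' : gwa_nf h' -> gwa_nf (gr s * h').
    by apply: nf_mul => r j; rewrite mulrA -gwa_rM; exact: gwa_nf_w.
  move: g h; apply: gwa_ind.
  - split=> [c h hh|x y hx hy h hh|x y hx hy h hh].
    + by rewrite -gwa_r1 -gwa_rZ; exact: nf_r.
    + by rewrite mulrDl; apply: gwa_nfD; [exact: hx | exact: hy].
    + by rewrite -mulrA; apply: hx; exact: hy.
  - exact: nf_r.
  - apply: nf_mul => r j; rewrite mulrA gwa_xr -mulrA; have [t ->] := gwa_x_w j.
    by rewrite mulrA -gwa_rM; exact: gwa_nf_w.
  - apply: nf_mul => r j; rewrite mulrA gwa_yr -mulrA; have [t ->] := gwa_y_w j.
    by rewrite mulrA -gwa_rM; exact: gwa_nf_w.
move=> hu {}h [L [n]]; elim: n h => [|n IH] h /=.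
  by move=> ->; rewrite mulr0; exists 0%N, 0%N.
move=> [r [h' [/IH hh ->]]]; rewrite mulrDr.
by apply: gwa_nfD; [exact: hu | exact: hh].
Qed.

Lemma gwa_fil_bound L n g k m : gwa_fil L n g -> supp_le k m ->
  supp_le (k + (n%:Z - L%:Z) - 1) (tau g m).
Proof.
move=> + sm; elim: n g => [|n IH] g /=; first by move=> -> i _; rewrite act0l.
move=> [r [g' [/IH h ->]]] i ki; rewrite actDl.
have [rho _ tw] := top_w (n%:Z - L%:Z).
have [s _] := topM (top_r r) tw sm.
rewrite [LHS](_ : _ = tau (gr r * gwa_w (n%:Z - L%:Z)) m i + tau g' m i) //.
rewrite s ?h ?addr0 //; lia.
Qed.

(** The highest nonzero coefficient of a normal form decides: by [gwa_fil_bound], the lower terms do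
    not reach that degree. *)
Lemma gwa_top g : g != 0 -> exists N, exists2 rho, rho != 0 & top N rho g.
Proof.
have [L [n]] := gwa_nfP g; elim: n g => [|n IH] g /=.
  by move=> ->; rewrite eqxx.
move=> [r [g' [hg' ->]]]; have [->|r0 _] := eqVneq r 0.
  by rewrite gwa_r0 mul0r add0r => /IH; apply.
have [rho rho0 tw] := top_w (n%:Z - L%:Z).
exists (n%:Z - L%:Z), (v r * rho); first by rewrite mulf_neq0 ?v0.
have := topM (top_r r) tw; rewrite add0r => t k m sm.
have [s E] := t _ _ sm; have s' := gwa_fil_bound hg' sm.
rewrite actDl; split=> [i ki|].
  rewrite [LHS](_ : _ = tau (gr r * gwa_w (n%:Z - L%:Z)) m i + tau g' m i) //.
  by rewrite s ?s' ?addr0 //; lia.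
rewrite -E; congr v.
rewrite [LHS](_ : _ = tau (gr r * gwa_w (n%:Z - L%:Z)) m (k + (n%:Z - L%:Z)) +
  tau g' m (k + (n%:Z - L%:Z))) //.
by rewrite s' ?addr0 //; lia.
Qed.

Definition delta0 : M := fun n : int => if n == 0 then 1 else 0.

Lemma supp_delta0 : supp_le 0 delta0.
Proof. by move=> n n0; rewrite /delta0 gt_eqF. Qed.

Lemma top_delta0 N rho g : top N rho g -> v (tau g delta0 N) = rho.
Proof. by move=> /(_ _ _ supp_delta0)[_]; rewrite add0r /delta0 eqxx v1 mulr1. Qed.

Lemma gwa_r_inj r : gr r = 0 -> r = 0.
Proof.
move=> E; have := tau_r r delta0 0; rewrite E act0l /delta0 eqxx mulr1.
exact: esym.
Qed.

(** Top coefficients multiply in the field K, so a product of nonzero elements acts nontrivially on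
    [delta0]. *)
Lemma gwa_domain : domain_alg G.
Proof.
split=> [|g h E].
  by rewrite -gwa_r1; apply/eqP => /gwa_r_inj/eqP; rewrite oner_eq0.
have [->|/gwa_top[N [rho rho0 tg]]] := eqVneq g 0; first by left.
have [->|/gwa_top[N' [rho' rho'0 th]]] := eqVneq h 0; first by right.
have /eqP := top_delta0 (topM tg th); rewrite E act0l v00 eq_sym mulf_eq0.
by rewrite (negPf rho0) (negPf rho'0).
Qed.

Lemma gwa_no_qcommuting (c : K) (g h : G) : (forall d (r : R), v (d *: r) = d * v r) ->
  g != 0 -> h != 0 -> g * h = c *: (h * g) -> c = 1.
Proof.
move=> vZ /gwa_top[N [rho rho0 tg]] /gwa_top[N' [rho' rho'0 th]] E.
have := top_delta0 (topM tg th); rewrite E actZl addrC.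
have := top_delta0 (topM th tg); set f := tau (h * g) delta0 => Ef.
rewrite -[(c *: f) _]/(c *: f (N' + N)) vZ Ef [rho * _]mulrC => E'.
apply: (mulIf (mulf_neq0 rho'0 rho0)); rewrite mul1r; exact: E'.
Qed.

End GwaDomain.

(** * The theorem *)

Section Transfer.
Variables (K : fieldType) (q alpha b : K) (A B : algebra K).
Variable f : {rmorphism A -> B}.
Hypothesis fZ : scalable f.

Lemma b2_relations_morph x1 x2 x3 : b2_relations q alpha b x1 x2 x3 ->
  b2_relations q alpha b (f x1) (f x2) (f x3).
Proof.
move=> [r1 r2 r3 r4].
have f1 c : f (c *: (1 : A)) = c *: (1 : B) by rewrite fZ rmorph1.
split.
- by rewrite -rmorphM r1 rmorphD /= fZ rmorphM.
- by rewrite -rmorphM r2 /= fZ rmorphM.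
- by rewrite -rmorphM r3 rmorphD /= f1 fZ rmorphM.
- by rewrite -f1 -r4 rmorphD rmorphM rmorphD /= !fZ rmorphM.
Qed.

Lemma domain_alg_inj : injective f -> domain_alg B -> domain_alg A.
Proof.
move=> fI [nz dom]; split=> [|x y E].
  by apply: contraNneq nz => E; rewrite -(rmorph1 f) E rmorph0.
have : f x * f y = 0 by rewrite -rmorphM E rmorph0.
by case/dom => E'; [left | right]; apply: fI; rewrite E' rmorph0.
Qed.

End Transfer.

(** * Absence of one-dimensional modules *)

Section NoCharacter.
Variables (K : fieldType) (q alpha b : K).
Hypotheses (q0 : q != 0) (q_inf : forall n, (0 < n)%N -> q ^+ n != 1).
Hypothesis alpha0 : alpha != 0.

Lemma qV2_neq1 : q ^- 2 != 1.
Proof. by rewrite invr_eq1 q_inf. Qed.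

(** Values of a character commute, so x1 x3 = q^-2 x3 x1 makes that of [x1] or [x3] zero. But a zero
    value at [x1] gives one at [x3], and a zero value at [x3] gives alpha = 0. *)
Lemma b2_no_character (B : algebra K) (x1 x2 x3 : B) (tau : action B K^o) :
  b2_relations q alpha b x1 x2 x3 -> False.
Proof.
move=> [r1 r2 r3 _]; pose c g : K := tau g 1.
have tE g (m : K) : tau g m = m * c g.
  have := actZr tau m g 1; rewrite -[tau g 1]/(c g) => E.
  by rewrite -[LHS]/(tau g (m : K^o)) -[m in LHS]mulr1; exact: E.
have cM g h : c (g * h) = c g * c h by rewrite /c actM tE mulrC.
have cD g h : c (g + h) = c g + c h by rewrite /c actDl.
have cZ d g : c (d *: g) = d * c g by rewrite /c actZl.
have c1 : c 1 = 1 by rewrite /c act1.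
have e3 : c x1 * c x2 = q ^+ 2 * (c x2 * c x1) + c x3.
  by rewrite -cM r1 cD cZ cM.
have e13 : c x1 * c x3 = q ^- 2 * (c x3 * c x1) by rewrite -cM r2 cZ cM.
have e23 : c x2 * c x3 = q ^+ 2 * (c x3 * c x2) + alpha.
  by rewrite -cM r3 cD !cZ cM c1 mulr1.
have c30 : c x3 != 0.
  apply: contraNneq alpha0 => E; move: e23.
  by rewrite E mulr0 mul0r mulr0 add0r => <-.
have c10 : c x1 != 0.
  apply: contraNneq c30 => E; move: e3.
  by rewrite E mulr0 mul0r mulr0 add0r => <-.
have := qV2_neq1; rewrite -[X in X != _]mulr1 => /eqP; apply.
apply: (mulIf (mulf_neq0 c30 c10)).
by rewrite mulr1 mul1r -e13 mulrC.
Qed.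

Variables (R : algType K) (sigma : {lrmorphism R -> R}) (sigma' : R -> R) (a : R).
Hypothesis s'K : cancel sigma' sigma.
Variable ev : {rmorphism R -> K}.
Hypotheses (evZ : forall c r, ev (c *: r) = c * ev r).
Hypotheses (evs : forall r, ev (sigma r) = ev r).

(** A sigma-invariant evaluation extends to a character by x |-> 1 and y |-> ev a. *)
Lemma gwa_character (x1 x2 x3 : gwa sigma sigma' a) :
  b2_relations q alpha b x1 x2 x3 -> False.
Proof.
have evs' r : ev (sigma' r) = ev r by rewrite -(evs (sigma' r)) s'K.
have [] := @gwa_action K R sigma sigma' a (K^o : lmodType K)
  (fun r m => ev r * m) id (fun m => ev a * m).
- by move=> r c m n; rewrite mulrDr scalerAr.
- by [].
- by move=> c m n; rewrite mulrDr scalerAr.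
- by move=> m c r s; rewrite rmorphD evZ mulrDl -mulrA.
- by move=> m; rewrite rmorph1 mul1r.
- by move=> r s m; rewrite rmorphM mulrA.
- by move=> r m; rewrite evs.
- by move=> r m; rewrite evs' !mulrA [ev a * _]mulrC.
- by move=> m; rewrite evs.
- by [].
by move=> tau _; exact: b2_no_character.
Qed.

End NoCharacter.

(** * The base ring K[h] *)

Section PolyCase.
Variables (K : fieldType) (q alpha beta : K).
Hypotheses (q0 : q != 0) (q_inf : forall n, (0 < n)%N -> q ^+ n != 1).
Hypothesis alpha0 : alpha != 0.

Lemma lrmorph_polyE (sigma : {lrmorphism {poly K} -> {poly K}}) p :
  sigma p = p \Po sigma 'X.
Proof.
elim/poly_ind: p => [|p c IH]; first by rewrite rmorph0 comp_poly0.
have EC : sigma c%:P = c%:P by rewrite -[c%:P]mulr1 mul_polyC linearZ_LR /= rmorph1.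
by rewrite rmorphD rmorphM /= IH EC comp_polyD comp_polyM comp_polyX comp_polyC.
Qed.

Lemma poly_not_iso : ~ iso_gwa_over (A_ q alpha beta) {poly K}.
Proof.
case=> sigma [sigma' [a [sK s'K a0 aC [f [fZ [g fK gK]]]]]].
have rel := b2_relations_morph fZ (@A_relations K q alpha beta q0 q_inf).
pose s := sigma 'X.
(* Degrees multiply under composition, and sigma (sigma' X) = X has degree 1. *)
have s2 : size s = 2.
  have : size (sigma (sigma' 'X)) = 2 by rewrite s'K size_polyX.
  rewrite lrmorph_polyE -/s => E; have := size_comp_poly (sigma' 'X) s.
  rewrite E /= => /esym/eqP; rewrite muln_eq1 => /andP[_].
  by case: (size s) => [|[|[|]]].
have sE : s = s`_1 *: 'X + (s`_0)%:P.
  apply/polyP => -[|[|i]]; rewrite coefD coefZ coefX coefC /= ?mulr0 ?mulr1 ?add0r ?addr0 //.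
  by rewrite nth_default // s2.
have no_fixpoint h : s.[h] != h.
  apply/eqP => sh; pose ev : {rmorphism {poly K} -> K} := horner_eval h.
  have evZ c r : ev (c *: r) = c * ev r by exact: hornerZ.
  have evs r : ev (sigma r) = ev r.
    by rewrite lrmorph_polyE; apply: etrans (horner_comp _ _ _) _; rewrite sh.
  exact: (gwa_character q_inf alpha0 s'K evZ evs rel).
have s11 : s`_1 = 1.
  apply/eqP; apply: contraTT isT => s1.
  (* The fixed point of an affine map of slope different from 1. *)
  have := no_fixpoint (s`_0 / (1 - s`_1)).
  rewrite sE hornerD hornerZ hornerX hornerC => /eqP[].
  rewrite -sE; field; rewrite subr_eq0 eq_sym //.
have lc p : lead_coef (sigma p) = lead_coef p.
  rewrite lrmorph_polyE lead_coef_comp -/s ?s2 // [lead_coef s]lead_coefE s2 /=.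
  by rewrite s11 expr1n mulr1.
have [tau [t1 t2 t3]] := gwa_shift_action sK s'K aC.
have v0 (r : {poly K}) : (lead_coef r == 0) = (r == 0) by exact: lead_coef_eq0.
have dom := gwa_domain sK s'K a0 (@lead_coefM K) (lead_coef1 K) v0 lc t1 t2 t3.
have := gwa_no_qcommuting sK s'K a0 (@lead_coefM K) (lead_coef1 K) v0 lc t1 t2 t3 (@lead_coefZ K)
   (x1_neq0 alpha0 rel dom) (x3_neq0 alpha0 rel dom).
case: rel => _ r13 _ _ /(_ _ r13)/eqP.
by apply/negP/qV2_neq1.
Qed.

End PolyCase.

Lemma comm_affine (K : comPzRingType) (A : algebra K) (u x y : A) (c : K) :
  u * x = x * u -> u * y = y * u ->
  u * (x * y + c *: (1 : A)) = (x * y + c *: (1 : A)) * u.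
Proof.
move=> E E'; rewrite mulrDr mulrDl algZl algZr mul1r mulr1.
by congr (_ + _); rewrite mulrA E -mulrA E' mulrA.
Qed.

Lemma comm_cancel (K : fieldType) (A : algebra K) (u x y : A) : domain_alg A ->
  x != 0 -> u * x = x * u -> u * (x * y) = x * y * u -> u * y = y * u.
Proof.
move=> [_ dom] x0 E E'; apply/eqP; rewrite -subr_eq0.
have /dom[/eqP|/eqP //] : x * (u * y - y * u) = 0.
  by rewrite mulrBr mulrA -E -mulrA E' !mulrA subrr.
by rewrite (negPf x0).
Qed.

Lemma domain_alg_cancelr (K : fieldType) (A : algebra K) (x y z : A) :
  domain_alg A -> z != 0 -> x * z = y * z -> x = y.
Proof.
move=> [_ dom] z0 E; apply/eqP; rewrite -subr_eq0.
have /dom[/eqP //|/eqP] : (x - y) * z = 0 by rewrite mulrBl E subrr.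
by rewrite (negPf z0).
Qed.

Lemma commutant_subalgebra (K : fieldType) (A : algebra K) (u : A) :
  subalgebra (fun x => u * x = x * u).
Proof.
split=> [c|x y E E'|x y E E']; first by rewrite algZl algZr mul1r mulr1.
- by rewrite mulrDl mulrDr E E'.
- by rewrite mulrA E -mulrA E' mulrA.
Qed.

(** * The base ring K[h, h^-1] *)

Section LaurentCase.
Variables (K : fieldType) (q alpha beta s : K).
Hypotheses (q0 : q != 0) (q_inf : forall n, (0 < n)%N -> q ^+ n != 1).
Hypotheses (alpha0 : alpha != 0) (beta0 : beta != 0).

Let b := beta / (1 - q ^- 2).

Hypothesis s2 : s ^+ 2 = b.

Lemma laurent_domain (x y : laurent K) : (x * y == 0) = (x == 0) || (y == 0).
Proof. by rewrite -!(inj_eq val_inj) rmorphM rmorph0 mulf_eq0. Qed.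

Lemma laurent_polyX_unit : exists y : laurent K, laurent_poly 'X * y = 1.
Proof.
have P : laurent_pred (tofrac ('X : {poly K}))^-1.
  by apply/asboolP; exists 1, 1%N; rewrite rmorph1 div1r expr1.
exists (Sub _ P); apply: val_inj; rewrite rmorphM rmorph1; apply: mulfV.
by rewrite tofrac_eq0 polyX_eq0.
Qed.

Lemma laurentP (r : laurent K) :
  exists p n, laurent_poly 'X ^+ n * r = laurent_poly p.
Proof.
case: r => x P; have /asboolP[p [n E]] := P; exists p, n.
apply: val_inj; rewrite rmorphM rmorphXn /= E mulrCA mulfV ?mulr1 //.
by rewrite expf_neq0 // tofrac_eq0 polyX_eq0.
Qed.

Lemma laurent_not_iso : ~ iso_gwa_over (A_ q alpha beta) (laurent K).
Proof.
case=> sigma [sigma' [a [sK s'K a0 aC [f [fZ [g fK gK]]]]]].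
have rel := @A_relations K q alpha beta q0 q_inf.
(* Multiplicative because the ring is a domain, invariant because sigma is injective. *)
pose v (r : laurent K) : K := (r != 0)%:R.
have vM r t : v (r * t) = v r * v t.
  by rewrite /v laurent_domain negb_or -natrM mulnb.
have v1 : v 1 = 1 by rewrite /v oner_neq0.
have v0 r : (v r == 0) = (r == 0).
  by rewrite /v; case: (eqVneq r 0) => _; rewrite ?eqxx ?oner_eq0.
have vs r : v (sigma r) = v r.
  have -> : v (sigma r) = (sigma r != sigma 0)%:R by rewrite rmorph0.
  by rewrite (inj_eq (can_inj sK)).
have [tau [t1 t2 t3]] := gwa_shift_action sK s'K aC.
have domG := gwa_domain sK s'K a0 vM v1 v0 vs t1 t2 t3.
have domA := domain_alg_inj (can_inj fK) domG.
have [nz dom] := domG.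
pose gr := gwa_r sigma sigma' a; pose gx := gwa_x sigma sigma' a.
pose gy := gwa_y sigma sigma' a.
have q2 : 1 - q ^- 2 != 0 by rewrite subr_eq0 eq_sym qV2_neq1.
have b0 : b != 0 by rewrite mulf_neq0 ?invr_neq0.
have g0 : (1 + q ^- 2) * alpha != 0.
  rewrite mulf_neq0 //; have := q_inf (n := 4) isT; apply: contraNneq => E.
  have -> : q ^+ 4 = (q ^+ 2 - 1) * q ^+ 2 * (1 + q ^- 2) + 1 by field.
  by rewrite E mulr0 add0r.
(* The solution of the weight equation of [A_verma] for s = 0; the other module has weights s and
   0. *)
pose lambda := q ^+ 2 * b / ((1 + q ^- 2) * alpha).
have [|tau1 [w1 w10 [tx1 tx3]]] := @A_verma K q alpha beta q0 q_inf s 0 (mulr0 s).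
  by rewrite mulr0 addr0 s2.
have [|tau2 [w2 w20 [ty1 ty3]]] := @A_verma K q alpha beta q0 q_inf 0 lambda (mul0r _).
  rewrite expr0n add0r /lambda -/b; move: g0; move: (_ * alpha) => G G0.
  by field; rewrite q0 G0.
have [y hy] := laurent_polyX_unit.
pose h := laurent_poly ('X : {poly K}).
have fI := can_inj fK.
have fg u t : gr u * gr t = 1 -> g (gr u) * g (gr t) = 1.
  by move=> E; apply: fI; rewrite rmorphM !gK E rmorph1.
have hy1 : gr h * gr y = 1 by rewrite -gwa_rM hy gwa_r1.
have yh1 : gr y * gr h = 1 by rewrite -gwa_rM mulrC hy gwa_r1.
have central u : u * gr h = gr h * u.
  rewrite scale0r in tx1; rewrite scale0r in ty3.
  have E := unit_central q0 q_inf alpha0 b0 rel domA (@A_ind K q alpha beta)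
    (fg _ _ yh1) w10 w20 tx1 tx3 ty3 ty1 s2 erefl (g u).
  have gM t : f (g u * g t) = u * t by rewrite rmorphM !gK.
  have gM' t : f (g t * g u) = t * u by rewrite rmorphM !gK.
  by rewrite -gM -gM' E.
have h0 : gr h != 0.
  by apply: contraNneq nz => E; rewrite -hy1 E mul0r.
have grD r t : gr (r + t) = gr r + gr t by exact: gwa_rD.
have grM r t : gr (r * t) = gr r * gr t by exact: gwa_rM.
have grC c : gr (c *: (1 : laurent K)) = c *: (1 : gwa sigma sigma' a).
  by apply: etrans (gwa_rZ _ _ _ _ _) _; rewrite gwa_r1.
have centralP p u : u * gr (laurent_poly p) = gr (laurent_poly p) * u.
  elim/poly_ind: p => [|p c IH]; first by rewrite rmorph0 [gr 0]gwa_r0 mulr0 mul0r.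
  have -> : gr (laurent_poly (p * 'X + c%:P)) =
      gr (laurent_poly p) * gr h + c *: (1 : gwa sigma sigma' a).
    apply: etrans (congr1 gr (rmorphD _ _ _)) _; apply: etrans (grD _ _) _.
    apply: (congr2 +%R).
      by apply: etrans (congr1 gr (rmorphM _ _ _)) _; exact: grM.
    by apply: etrans (congr1 gr (esym (mulr1 _))) _; exact: grC.
  exact: comm_affine IH (central u).
have centralX n u : u * gr (h ^+ n) = gr (h ^+ n) * u.
  by rewrite /h -rmorphXn; exact: centralP.
have centralR r u : u * gr r = gr r * u.
  (* h^n r is a polynomial in h, hence central, and so is h^n, which cancels in the domain. *)
  have [p [n E]] := laurentP r.
  have hn0 : gr (h ^+ n) != 0.
    elim: n {E} => [|n IH]; first by rewrite expr0 [gr 1]gwa_r1.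
    rewrite exprS grM; apply/eqP => /dom[/eqP|/eqP].
      exact/negP.
    exact/negP.
  apply: (comm_cancel domG hn0 (centralX n u)).
  have -> : gr (h ^+ n) * gr r = gr (laurent_poly p).
    exact: etrans (esym (grM _ _)) (congr1 gr E).
  exact: centralP.
have gx0 : gx != 0.
  apply: contraNneq a0 => E; apply/eqP; apply: (gwa_r_inj t1).
  by rewrite -gwa_yx -/gx E mulr0.
(* Cancel x in x r = sigma(r) x, using that r is central. *)
have sgr r : gr (sigma r) = gr r.
  apply: (domain_alg_cancelr domG gx0).
  have := gwa_xr sigma sigma' a r; rewrite -/gx -/(gr _) -/(gr _) centralR.
  exact: esym.
have xy : gx * gy = gy * gx by rewrite gwa_xy gwa_yx; exact: sgr.
have commx t : gx * t = t * gx.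
  exact: (@gwa_ind K (laurent K) sigma sigma' a (fun t => gx * t = t * gx) (commutant_subalgebra gx)
    (fun r => centralR r gx) erefl xy t).
have commy t : gy * t = t * gy.
  exact: (@gwa_ind K (laurent K) sigma sigma' a (fun t => gy * t = t * gy) (commutant_subalgebra gy)
    (fun r => centralR r gy) (esym xy) erefl t).
have comm (u t : gwa sigma sigma' a) : u * t = t * u.
  exact: (@gwa_ind K (laurent K) sigma sigma' a (fun t => u * t = t * u) (commutant_subalgebra u)
    (fun r => centralR r u) (esym (commx u)) (esym (commy u)) t).
case: rel (x1_neq0 alpha0 rel domA) (x3_neq0 alpha0 rel domA) => _ r13 _ _ x10 x30.
have E : (1 - q ^- 2) *: (a3 q alpha beta * a1 q alpha beta) = 0.
  rewrite scalerBl scale1r -r13; apply/eqP; rewrite subr_eq0; apply/eqP.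
  apply: fI; apply: etrans (rmorphM f _ _) _; apply: etrans (comm _ _) _.
  exact: esym (rmorphM f _ _).
have [_ domA'] := domA.
have /domA'[/eqP|/eqP] : a3 q alpha beta * a1 q alpha beta = 0.
  by apply: (scalerI q2); rewrite E scaler0.
- exact/negP.
- exact/negP.
Qed.

End LaurentCase.

Theorem proposition3p11 (R : realType) (q alpha beta : R[i])
    (hq0 : q != 0)
    (hq : forall n : nat, (0 < n)%N -> ~~ n.-unity_root q)
    (halpha : alpha != 0) (hbeta : beta != 0) :
  ~ iso_gwa_over (A_ q alpha beta) {poly R[i]} /\
  ~ iso_gwa_over (A_ q alpha beta) (laurent R[i]).
Proof.
have q_inf n : (0 < n)%N -> q ^+ n != 1 by move/hq; rewrite unity_rootE.
split; first exact: poly_not_iso.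
(* The eigenvalue s of e3 is a complex square root of beta / (1 - q^-2). *)
exact: (laurent_not_iso hq0 q_inf halpha hbeta (sqrtCK (beta / (1 - q ^- 2)))).
Qed.
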